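(* For every integer $n\ge 3$, the maximum number of real embeddings of rigid graphs in $\mathbb{R}^3$ with $n$ vertices is bounded from below by $$2^{(n-3)\bmod 5}\; 132^{\lfloor (n-3)/5\rfloor}.$$ This bound asymptotically behaves as $2.6553^{n}$ (that is, up to bounded factors it grows like $(132^{1/5})^n$, with $132^{1/5}\approx 2.6553$).
   Context: All graphs are finite and simple. An embedding of a graph $G=(V_G,E_G)$ in $\mathbb{R}^3$ is a map $V_G\to\mathbb{R}^3$; it is compatible with edge lengths $\mathbf{d}=(d_e)_{e\in E_G}\in\mathbb{R}_+^{|E_G|}$ if for every edge $uv$ the Euclidean distance between the images of $u$ and $v$ is $d_{uv}$. $G$ is (generically) rigid in $\mathbb{R}^3$ if all embeddings compatible with generic edge lengths are not continuously deformable (other than by rigid motions). $r_3(G,\mathbf{d})$ is the number of embeddings in $\mathbb{R}^3$ compatible with $\mathbf{d}$ modulo rigid motions (rotations and translations; mirror images are counted separately, so the tetrahedron has $2$ embeddings). $r_3(G)$ is the maximum of $r_3(G,\mathbf{d})$ over all $\mathbf{d}\in\mathbb{R}_+^{|E_G|}$ for which $r_3(G,\mathbf{d})$ is finite. The maximum number of real embeddings of rigid graphs with $n$ vertices is the maximum of $r_3(G)$ over all rigid graphs $G$ in $\mathbb{R}^3$ with $n$ vertices. *)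

(* Defs.v *)
From HB Require Import structures.
From mathcomp Require Import all_boot all_order all_algebra.
From mathcomp Require Import finmap.
From mathcomp Require Import all_classical all_reals all_analysis.
From mathcomp Require mpoly.

Set Implicit Arguments.
Unset Strict Implicit.
Unset Printing Implicit Defensive.

Import Order.TTheory GRing.Theory Num.Theory.
Import numFieldNormedType.Exports.

Local Open Scope classical_set_scope.
Local Open Scope ring_scope.

(* Finite simple graphs: the edges are 2-element sets of vertices. *)
Record sgraph (V : finType) := SGraph {
  edges : {set {set V}};
  edges_card2 : forall e, e \in edges -> #|e| = 2%N
}.

Definition edge (V : finType) (G : sgraph V) := {e : {set V} | e \in edges G}.

(* The library norm on ['rV[R]_3] is the sup norm, hence this definition; the
   topology is the same. *)
Definition edist (R : realType) (x y : 'rV[R]_3) : R :=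
  Num.sqrt (\sum_(i < 3) (x ord0 i - y ord0 i) ^+ 2).

Definition embedding (R : realType) (V : finType) := V -> 'rV[R]_3.

Definition compatible (R : realType) (V : finType) (G : sgraph V)
    (d : edge G -> R) (p : embedding R V) : Prop :=
  forall (e : edge G) (u v : V), val e = [set u; v]%SET ->
    edist (p u) (p v) = d e.

(* Equality up to rotation and translation; [\det A = 1] makes mirror images
   distinct unless a rotation also relates them. *)
Definition congruent (R : realType) (V : finType) (p q : embedding R V) : Prop :=
  exists (A : 'M[R]_3) (t : 'rV[R]_3),
    [/\ A *m A^T = 1%:M, \det A = 1 & forall v, q v = p v *m A + t].

Definition deformable (R : realType) (V : finType) (G : sgraph V)
    (d : edge G -> R) (p : embedding R V) : Prop :=
  exists g : R -> embedding R V,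
    [/\ forall v, {within `[0, 1], continuous (fun t => g t v)},
        g 0 = p,
        forall t : R, t \in `[0, 1]%R -> compatible d (g t)
      & exists2 t : R, t \in `[0, 1]%R & ~ congruent p (g t)].

Definition sq_eval (R : realType) (V : finType) (G : sgraph V)
    (P : mpoly.mpoly #|{: edge G}| rat) (d : edge G -> R) : R :=
  mpoly.mmap ratr (fun i => d (enum_val i) ^+ 2) P.

(* [d] is generic when its squares satisfy no polynomial relation over the
   rationals besides those satisfied by the squared edge lengths of every
   embedding. If the squared lengths of distinct edges are algebraically
   independent functions of the embedding, this is algebraic independence of
   the [d e ^+ 2] (equivalently, of the [d e]). For overconstrained graphs plain
   algebraic independence would only select lengths having no compatible
   embedding. Squares are used because the Zariski closure of the set of squared
   length vectors is irreducible. *)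
Definition generic_lengths (R : realType) (V : finType) (G : sgraph V)
    (d : edge G -> R) : Prop :=
  forall P : mpoly.mpoly #|{: edge G}| rat, sq_eval P d = 0 ->
    forall (d' : edge G -> R) (p : embedding R V),
      compatible d' p -> sq_eval P d' = 0.

Definition rigid (R : realType) (V : finType) (G : sgraph V) : Prop :=
  forall d : edge G -> R, (forall e, 0 < d e) -> generic_lengths d ->
    forall p : embedding R V, compatible d p -> ~ deformable d p.

Definition classes (R : realType) (V : finType) (G : sgraph V)
    (d : edge G -> R) : set (set (embedding R V)) :=
  [set [set q | congruent p q] | p in [set p | compatible d p]].

(* Meaningful only when [classes d] is finite. *)
Definition r3_at (R : realType) (V : finType) (G : sgraph V)
    (d : edge G -> R) : nat :=
  #|` fset_set (classes d)|%fset.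

(* The maxima are suprema in the extended reals: of a set of natural numbers,
   the supremum is the maximum whenever the latter exists. *)
Definition r3 (R : realType) (V : finType) (G : sgraph V) : \bar R :=
  ereal_sup [set ((r3_at d)%:R)%:E | d in
    [set d : edge G -> R | (forall e, 0 < d e) /\ finite_set (classes d)]].

Definition max_real_embeddings (R : realType) (n : nat) : \bar R :=
  ereal_sup [set r3 R G | G in [set G : sgraph 'I_n | rigid R G]].

Definition embedding_bound (n : nat) : nat :=
  (2 ^ ((n - 3) %% 5) * 132 ^ ((n - 3) %/ 5))%N.

(* Main.v *)
(* Gluing along a common triangle multiplies numbers of embeddings, so it is
   enough to attach to a triangle copies of a graph with 5 further vertices and
   132 embeddings, and vertices joined to the three corners of the triangle, each
   of which doubles the number of embeddings.

   The graph with 132 embeddings is the snub disphenoid (8 vertices, 18 edges).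
   Let t and u be the squared distances of the two pairs of non-adjacent vertices
   of degree five. The tetrahedra on the first pair form a chain, which determines
   u from t up to orientations; exchanging the pairs, another chain determines t
   from u. Interval arithmetic and the intermediate value theorem give 66 pairs
   (t, u) satisfying both conditions, for all lengths in a small open box, and
   each pair gives two mirror images.

   Finiteness and rigidity come from a count: the squared lengths of an embedding
   are polynomials in its coordinates in the frame of the triangle (and in the
   Gram matrix of the triangle), and there are as many edges as coordinates. Hence
   each coordinate satisfies a polynomial equation over the squared lengths. Its
   coefficients do not all vanish on the open box of realizable lengths, so they
   do not all vanish at generic lengths: there, each coordinate takes finitely
   many values, and is constant along a continuous deformation. *)
From Stdlib Require Import ZArith.
From mathcomp Require Import all_boot all_order all_algebra.
From mathcomp Require Import ring lra zify ssrZ.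
From mathcomp Require mpoly.
From mathcomp Require Import all_classical all_reals all_analysis.
Require Import Defs.
Import (canonicals) mpoly.
Import Order.TTheory GRing.Theory Num.Theory.
Import numFieldNormedType.Exports.
Set Implicit Arguments.
Unset Strict Implicit.
Unset Printing Implicit Defensive.
Local Open Scope classical_set_scope.
Local Open Scope ring_scope.

(** * Polynomial relations between coordinates and squared lengths *)

(** Elimination rests on comparing the sizes of two grids, and polynomials in the coordinates enter
    only as functions that are polynomial in each variable separately. The frame of the triangle is
    left unnormalised, its third vector being the cross product of two sides: squared lengths are
    then polynomials with rational coefficients in the frame coordinates, free of square roots.

    The interval computation has to hold on an open box rather than at one length vector, for two
    reasons. Lengths at which the equations for the coordinates are nontrivial are only known to
    exist somewhere in a given box, and all blocks glued to the triangle must tolerate the same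
    perturbation of its sides. Distinctness of solutions comes from disjoint boxes in the plane of
    (t, u), and finiteness from elimination; so positivity and a sign change on each bracket, both
    stable under the perturbation, are what has to be certified besides disjointness. *)

Definition upd (I : finType) (R : Type) (x : {ffun I -> R}) (i : I) (t : R) :=
  [ffun j => if j == i then t else x j].

Lemma upd_id (I : finType) (R : Type) (x : {ffun I -> R}) i : upd x i (x i) = x.
Proof. by apply/ffunP => j; rewrite ffunE; case: eqP => [->|]. Qed.

(** Polynomiality of degree at most [d] along every line parallel to an axis. The grid arguments use
    only this, and it passes to sums and products without any calculus of monomials. *)
Definition sep_poly (R : idomainType) (I : finType) (d : nat)
    (f : {ffun I -> R} -> R) : Prop :=
  forall i x, exists2 p : {poly R}, (size p <= d.+1)%N &
    forall t, f (upd x i t) = p.[t].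

Section SepPoly.
Context (R : idomainType) (I : finType).
Implicit Types (f g : {ffun I -> R} -> R) (d : nat).

Lemma sep_poly_le d d' f : (d <= d')%N -> sep_poly d f -> sep_poly d' f.
Proof.
move=> dd' fP i x; have [p sp pE] := fP i x.
by exists p => //; apply: leq_trans sp _.
Qed.

Lemma sep_poly_ext d f g : f =1 g -> sep_poly d f -> sep_poly d g.
Proof.
move=> fg fP i x; have [p sp pE] := fP i x.
by exists p => // t; rewrite -fg.
Qed.

Lemma sep_poly_cst d c : sep_poly d (fun _ : {ffun I -> R} => c).
Proof.
move=> i x; exists c%:P => [|t]; last by rewrite hornerC.
by rewrite size_polyC; case: (c != 0).
Qed.

Lemma sep_poly_proj i : sep_poly 1 (fun x : {ffun I -> R} => x i).
Proof.
move=> j x; have [<-|ji] := eqVneq i j.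
  by exists 'X => [|t]; rewrite ?size_polyX// hornerX ffunE eqxx.
exists (x i)%:P => [|t]; first by rewrite size_polyC; case: (_ != 0).
by rewrite hornerC ffunE (negPf ji).
Qed.

Lemma sep_polyD d f g :
  sep_poly d f -> sep_poly d g -> sep_poly d (fun x => f x + g x).
Proof.
move=> fP gP i x; have [p sp pE] := fP i x; have [q sq qE] := gP i x.
exists (p + q) => [|t]; last by rewrite hornerD pE qE.
by rewrite (leq_trans (size_polyD _ _))// geq_max sp.
Qed.

Lemma sep_polyM d d' f g :
  sep_poly d f -> sep_poly d' g -> sep_poly (d + d') (fun x => f x * g x).
Proof.
move=> fP gP i x; have [p sp pE] := fP i x; have [q sq qE] := gP i x.
exists (p * q) => [|t]; last by rewrite hornerM pE qE.
have := size_polyMleq p q; lia.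
Qed.

Lemma sep_polyN d f : sep_poly d f -> sep_poly d (fun x => - f x).
Proof.
move=> fP i x; have [p sp pE] := fP i x.
by exists (- p) => [|t]; rewrite ?size_polyN// hornerN pE.
Qed.

Lemma sep_polyX d n f : sep_poly d f -> sep_poly (d * n) (fun x => f x ^+ n).
Proof.
move=> fP; elim: n => [|n IH]; first by rewrite muln0; apply: sep_poly_cst.
rewrite mulnS; apply: (sep_poly_ext _ (sep_polyM fP IH)) => x.
by rewrite exprS.
Qed.

Lemma sep_poly_sum (T : Type) (r : seq T) d (F : T -> {ffun I -> R} -> R) :
  (forall k, sep_poly d (F k)) -> sep_poly d (fun x => \sum_(k <- r) F k x).
Proof.
move=> FP; elim: r => [|k r IH].
  by apply: (sep_poly_ext _ (sep_poly_cst d 0)) => x; rewrite big_nil.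
by apply: (sep_poly_ext _ (sep_polyD (FP k) IH)) => x; rewrite big_cons.
Qed.

Lemma sep_poly_prod (T : Type) (r : seq T) d (F : T -> {ffun I -> R} -> R) :
  (forall k, sep_poly d (F k)) ->
  sep_poly (size r * d) (fun x => \prod_(k <- r) F k x).
Proof.
move=> FP; elim: r => [|k r IH].
  by apply: (sep_poly_ext _ (sep_poly_cst _ 1)) => x; rewrite big_nil.
by apply: (sep_poly_ext _ (sep_polyM (FP k) IH)) => x; rewrite big_cons.
Qed.

Lemma sep_poly_horner d n (p : {poly R}) f : (size p <= n)%N ->
  sep_poly d f -> sep_poly (d * n) (fun x => p.[f x]).
Proof.
move=> pn fP.
have H : sep_poly (d * n) (fun x => \sum_(i <- iota 0 (size p)) p`_i * f x ^+ i).
  have -> : iota 0 (size p) = [seq val k | k <- enum 'I_(size p)] by rewrite val_enum_ord.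
  apply: (@sep_poly_ext _ (fun x => \sum_(k <- enum 'I_(size p)) p`_k * f x ^+ k)).
    by move=> x; rewrite [RHS]big_map.
  apply: sep_poly_sum => k; rewrite -[(d * n)%N]add0n.
  apply: sep_polyM; first exact: sep_poly_cst.
  apply: sep_poly_le (sep_polyX k fP).
  by rewrite leq_mul2l (leq_trans (ltnW (ltn_ord k)))// orbT.
apply: (sep_poly_ext _ H) => x.
by rewrite horner_coef -[RHS](big_mkord xpredT (fun i => p`_i * f x ^+ i)) /index_iota subn0.
Qed.

(** Coordinates are fixed one at a time. Along coordinate [i] each [f k] restricts, through its
    current point, to a nonzero polynomial of degree at most [d]; the product over [k] has fewer
    roots than [S i] has elements, so one value serves all [k]. The points start out different and
    coincide once every coordinate is fixed. *)
Lemma common_nonzero (T : finType) d (f : T -> {ffun I -> R} -> R)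
    (x : T -> {ffun I -> R}) (S : I -> seq R) :
    (forall k, sep_poly d (f k)) -> (forall i, uniq (S i)) ->
    (forall i, #|T| * d < size (S i))%N -> (forall k, f k (x k) != 0) ->
  exists2 z : {ffun I -> R}, (forall i, z i \in S i) & forall k, f k z != 0.
Proof.
move=> fP uS sS fx.
suff H (s : seq I) : exists x' : T -> {ffun I -> R}, exists z : {ffun I -> R},
    (forall k, f k (x' k) != 0) /\
    forall i, i \in s -> z i \in S i /\ forall k, x' k i = z i.
  have [x' [z [nz Hz]]] := H (enum I); exists z => [i|k].
    by have [] := Hz i (mem_enum _ i).
  suff <- : x' k = z by [].
  by apply/ffunP => i; have [_ ->] := Hz i (mem_enum _ i).
elim: s => [|i s [x' [z [nz Hz]]]]; first by exists x, [ffun=> 0].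
have /fin_all_exists[p pP] : forall k, exists p : {poly R},
    (size p <= d.+1)%N /\ forall t, f k (upd (x' k) i t) = p.[t].
  by move=> k; have [q] := fP k i (x' k); exists q.
have p0 k : p k != 0.
  apply: contraNneq (nz k) => pk0.
  by have [_ /(_ (x' k i))] := pP k; rewrite upd_id pk0 horner0 => ->.
have P0 : \prod_k p k != 0 by apply/prodf_neq0.
have sP : (size (\prod_k p k)%R <= (#|T| * d).+1)%N.
  apply: leq_trans (size_poly_prod_leq _ _) _.
  have : (\sum_k size (p k) <= \sum_(k : T) d.+1)%N.
    by apply: leq_sum => k _; have [] := pP k.
  by rewrite sum_nat_const mulnS leq_subLR addnS ltnS.
have [t tS rt] : exists2 t, t \in S i & (\prod_k p k).[t] != 0.
  apply/allPn/negP => /allP rS.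
  have := max_poly_roots P0 (rs := S i); rewrite uS => /(_ _ isT)/=.
  have -> : all (root (\prod_k p k)) (S i).
    by apply/allP => t /rS.
  by move=> /(_ isT) /leq_trans/(_ sP); rewrite ltnS leqNgt sS.
exists (fun k => upd (x' k) i t), (upd z i t); split=> [k|j].
  have [_ ->] := pP k; apply: contraNneq rt => pk0.
  by rewrite horner_prod (bigD1 k)//= pk0 mul0r.
rewrite inE ffunE; have [->|ji] := eqVneq j i.
  by split=> // k; rewrite ffunE eqxx.
move=> /= /Hz[zS xz]; split=> // k.
by rewrite ffunE (negPf ji) xz.
Qed.
End SepPoly.

(** * Algebraic dependency by counting on grids *)

Section Dependency.
Context (R : numFieldType).

(** Lagrange basis for the nodes 0, ..., N - 1. In this basis coefficients are values on the grid,
    so a nonzero coefficient comes with a point where the polynomial does not vanish. *)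
Definition lagr (N : nat) (k : 'I_N) : {poly rat} :=
  \prod_(l < N | l != k) ((k%:R - l%:R)^-1 *: ('X - l%:R%:P)).

Lemma size_lagr N (k : 'I_N) : (size (lagr k) <= N)%N.
Proof.
apply: leq_trans (size_poly_prod_leq _ _) _.
have : (\sum_(l < N | l != k) size ((k%:R - l%:R : rat)^-1 *: ('X - l%:R%:P))
   <= \sum_(l < N | l != k) 2)%N.
  apply: leq_sum => l lk; rewrite size_scale ?size_XsubC// invr_eq0 subr_eq0.
  by rewrite eqr_nat eq_sym.
rewrite sum_nat_const => H; rewrite leq_subLR.
apply: leq_trans (_ : _ <= (#|[pred l : 'I_N | l != k]| * 2).+1)%N _.
  by rewrite ltnS.
have := cardC1 k; rewrite card_ord => Hc.
have -> : #|[pred l : 'I_N | l != k]| = N.-1 by rewrite -Hc; apply: eq_card.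
by have := ltn_ord k; lia.
Qed.

Lemma horner_lagr N (k l : 'I_N) : (lagr k).[l%:R] = (k == l)%:R.
Proof.
rewrite horner_prod; have [<-|kl] := eqVneq k l.
  apply: big1 => j jk; rewrite hornerZ hornerXsubC mulVf// subr_eq0 eqr_nat.
  by rewrite eq_sym.
by rewrite (bigD1 l) 1?eq_sym//= hornerZ hornerXsubC subrr mulr0 mul0r.
Qed.

Definition lagr_eval (J : finType) N (v : {ffun {ffun J -> 'I_N} -> rat})
    (y : {ffun J -> R}) : R :=
  \sum_g ratr (v g) * \prod_j (map_poly ratr (lagr (g j))).[y j].

Lemma lagr_eval_grid (J : finType) N (v : {ffun {ffun J -> 'I_N} -> rat})
    (g : {ffun J -> 'I_N}) :
  lagr_eval v [ffun j => (g j)%:R] = ratr (v g).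
Proof.
rewrite /lagr_eval (bigD1 g)//= [X in _ + X]big1 ?addr0 => [|h hg].
  rewrite big1 ?mulr1// => j _.
  by rewrite ffunE -[X in _.[X]](rmorph_nat (@ratr R)) horner_map horner_lagr eqxx rmorph1.
have [j hj] : exists j, h j != g j.
  apply/existsP; apply: contraR hg; rewrite negb_exists => /forallP H.
  by apply/eqP/ffunP => j; apply/eqP; rewrite -[_ == _]negbK.
rewrite (bigD1 j)//= ffunE -[X in _.[X]](rmorph_nat (@ratr R)) horner_map.
by rewrite horner_lagr (negPf hj) rmorph0 mul0r mulr0.
Qed.

Lemma sep_poly_lagr_eval (J I : finType) N d
    (v : {ffun {ffun J -> 'I_N} -> rat}) (phi : J -> {ffun I -> R} -> R) :
    (forall j, sep_poly d (phi j)) ->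
  sep_poly (#|J| * (d * N)) (fun x => lagr_eval v [ffun j => phi j x]).
Proof.
move=> phiP; apply: sep_poly_sum => g; rewrite -[(_ * _)%N]add0n.
apply: sep_polyM; first exact: sep_poly_cst.
apply: (@sep_poly_ext _ _ _ (fun x => \prod_j (map_poly ratr (lagr (g j))).[phi j x])).
  by move=> x; apply: eq_bigr => j _; rewrite ffunE.
rewrite cardE enumT; apply: sep_poly_prod => j.
by apply: sep_poly_horner => //; rewrite size_map_poly size_lagr.
Qed.

(** Since [d + 1 <= (c + 1) N], it suffices that [(c + 1) ^ a * N ^ a < N * N ^ a <= N ^ b]; hence
    the choice of [N] just above [(c + 1) ^ a]. *)
Lemma grid_count (a b c : nat) : (a < b)%N ->
  exists N, forall d, (d <= c * N)%N -> (d.+1 ^ a < N ^ b)%N.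
Proof.
move=> ab; pose N := ((c + 1) ^ a).+1; exists N => d dN.
have N1 : (0 < N)%N by [].
apply: (@leq_ltn_trans (((c + 1) * N) ^ a)).
  by case: (a) => // k; rewrite leq_exp2r// mulnDl mul1n; lia.
rewrite expnMn; apply: (@leq_trans (N * N ^ a)).
  by rewrite ltn_pmul2r ?expn_gt0.
by rewrite -expnS leq_pexp2l.
Qed.

(* There are [N ^ #|J|] products of Lagrange polynomials to combine, while a
   function that is polynomial of degree at most [D] in each variable vanishes as
   soon as it does on a grid of [(D + 1) ^ #|X|] points. *)
Theorem algebraic_dependency (J X : finType) d
    (phi : J -> {ffun X -> R} -> R) (phiq : J -> {ffun X -> rat} -> rat) :
    (#|X| < #|J|)%N -> (forall j, sep_poly d (phi j)) ->
    (forall j (x : {ffun X -> rat}),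
      phi j [ffun i => ratr (x i)] = ratr (phiq j x)) ->
  exists N (v : {ffun {ffun J -> 'I_N} -> rat}) (g : {ffun J -> 'I_N}),
    v g != 0 /\ forall x, lagr_eval v [ffun j => phi j x] = 0.
Proof.
move=> XJ phiP phiE; have [N HN] := grid_count (#|J| * d) XJ.
pose D := (#|J| * (d * N))%N.
pose pt (k : {ffun X -> 'I_D.+1}) : {ffun X -> rat} := [ffun i => (k i)%:R].
(* The entries are rational because [phi] takes rational values at the grid points, so a vector of
   the left kernel is a combination with rational coefficients that vanishes on the whole grid. *)
pose M : 'M[rat]_(#|{ffun J -> 'I_N}|, #|{ffun X -> 'I_D.+1}|) :=
  \matrix_(a, b)
    \prod_j (lagr ((enum_val a : {ffun J -> 'I_N}) j)).[phiq j (pt (enum_val b))].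
have /rowV0Pn[u uM u0] : kermx M != 0.
  rewrite -mxrank_eq0 mxrank_ker subn_eq0 -ltnNge.
  apply: leq_ltn_trans (rank_leq_col _) _.
  by rewrite !card_ffun !card_ord; apply: HN; rewrite /D mulnA.
have {}uM : u *m M = 0 by apply/sub_kermxP.
have [a ua] : exists a, u 0 a != 0.
  by have /matrix0Pn[i [a]] := u0; rewrite ord1; exists a.
pose v := [ffun g => u 0 (enum_rank g)].
exists N, v, (enum_val a); rewrite ffunE enum_valK; split=> // x.
apply/eqP/negPn/negP => Fx.
pose S (i : X) : seq R := [seq (k : 'I_D.+1)%:R | k <- enum 'I_D.+1].
(* A nonzero value at [x] would give a nonzero value on the grid. *)
have [||||z zS] := @common_nonzero R X unit D
  (fun _ x => lagr_eval v [ffun j => phi j x]) (fun=> x) S.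
- by move=> _; apply: sep_poly_lagr_eval.
- move=> i; rewrite map_inj_uniq ?enum_uniq// => k l /eqP.
  by rewrite eqr_nat => /eqP/val_inj.
- by move=> i; rewrite size_map size_enum_ord card_unit mul1n.
- by [].
move=> /(_ tt)/eqP[].
have /fin_all_exists[k kE] : forall i, exists k : 'I_D.+1, z i = k%:R.
  by move=> i; have /mapP[k _ ->] := zS i; exists k.
pose b := enum_rank [ffun i => k i].
have := congr1 (fun A : 'rV_ _ => ratr (A 0 b) : R) uM.
rewrite !mxE rmorph0 rmorph_sum/= => <-.
rewrite /lagr_eval (reindex_onto enum_val enum_rank)/=; last by move=> ? _; exact: enum_rankK.
apply: eq_big => [i|i _]; first by rewrite enum_valK eqxx.
rewrite mxE rmorphM/= ffunE enum_valK; congr (_ * _).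
rewrite rmorph_prod; apply: eq_bigr => j _.
rewrite ffunE -horner_map /= -phiE; congr (_.[phi j _]).
by apply/ffunP => m; rewrite !ffunE enum_rankK ffunE kE rmorph_nat.
Qed.
End Dependency.

Lemma big_optionE (R : Type) (idx : R) (op : Monoid.com_law idx) (E : finType)
    (F : option E -> R) :
  \big[op/idx]_(j : option E) F j = op (F None) (\big[op/idx]_(e : E) F (Some e)).
Proof.
rewrite (bigD1 None)//=; congr (op _ _); rewrite (reindex_omap Some id)/=.
  by apply: eq_bigl => e; rewrite eqxx.
by case.
Qed.

(** * Polynomial equations for coordinates over the lengths *)

Section GenericFibre.
Context (R : realFieldType).

Definition rat_eval (E : finType) (P : mpoly.mpoly #|E| rat) (z : E -> R) : R :=
  mpoly.mmap ratr (fun i => z (enum_val i)) P.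

(** The coefficient of [y ^ k] in [lagr_eval v], the index [None] standing for [y]. It is a formal
    polynomial over the rationals because genericity of lengths quantifies over those. *)
Definition fibre_coef (E : finType) N
    (v : {ffun {ffun option E -> 'I_N} -> rat}) (k : nat) :
    mpoly.mpoly #|E| rat :=
  \sum_g (mpoly.mpolyC #|E| (v g * (lagr (g None))`_k) *
    \prod_e \sum_(m < N) mpoly.mpolyC #|E| (lagr (g (Some e)))`_m *
      (mpoly.mpolyX rat (mpoly.mnm1 (enum_rank e))) ^+ m).

Lemma rat_eval_fibre_coef (E : finType) N
    (v : {ffun {ffun option E -> 'I_N} -> rat}) (k : nat) (z : E -> R) :
  rat_eval (fibre_coef v k) z =
  \sum_g ratr (v g) * ratr (lagr (g None))`_k *
    \prod_e (map_poly ratr (lagr (g (Some e)))).[z e].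
Proof.
pose ev : {rmorphism mpoly.mpoly #|E| rat -> R} :=
  mpoly.mmap ratr (fun i => z (enum_val i)).
have evC c : ev (mpoly.mpolyC #|E| c) = ratr c by exact: mpoly.mmapC.
have evX e : ev (mpoly.mpolyX rat (mpoly.mnm1 (enum_rank e))) = z e.
  by rewrite [LHS]mpoly.mmapX mpoly.mmap1U enum_rankK.
transitivity (ev (fibre_coef v k)); first by [].
rewrite /fibre_coef rmorph_sum; apply: eq_bigr => g _.
rewrite rmorphM evC [ratr (_ * _)]rmorphM; congr (_ * _).
rewrite rmorph_prod; apply: eq_bigr => e _.
rewrite rmorph_sum (@horner_coef_wide _ N); last by rewrite size_map_poly size_lagr.
by apply: eq_bigr => m _; rewrite rmorphM evC rmorphXn evX coef_map.
Qed.

Definition option_cons (E : finType) (y : R) (z : E -> R) :=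
  [ffun j => oapp z y j].

Lemma lagr_eval_cons (E : finType) N
    (v : {ffun {ffun option E -> 'I_N} -> rat}) (y : R) (z : E -> R) :
  lagr_eval v (option_cons y z) =
  \sum_(k < N) rat_eval (fibre_coef v k) z * y ^+ k.
Proof.
under [RHS]eq_bigr do rewrite rat_eval_fibre_coef mulr_suml.
rewrite exchange_big/=; apply: eq_bigr => g _.
rewrite big_optionE/= ffunE (@horner_coef_wide _ N); last by rewrite size_map_poly size_lagr.
rewrite mulr_suml mulr_sumr; apply: eq_bigr => k _; rewrite coef_map/=.
under eq_bigr do rewrite ffunE/=.
by rewrite mulrA [_ * (_ * y ^+ k)]mulrA mulrAC.
Qed.

Lemma interval_points (lo hi : R) (n : nat) : lo < hi ->
  exists s : seq R, [/\ uniq s, size s = n & {in s, forall t, lo < t < hi}].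
Proof.
move=> lh; pose F (k : 'I_n) := lo + (hi - lo) * (k.+1%:R / n.+1%:R).
exists [seq F k | k <- enum 'I_n]; split.
- rewrite map_inj_uniq ?enum_uniq// => k l /addrI/mulfI H.
  have := H _; rewrite subr_eq0 gt_eqF// => /(_ isT)/divIf.
  rewrite pnatr_eq0 => /(_ isT)/eqP.
  by rewrite eqr_nat eqSS => /eqP/val_inj.
- by rewrite size_map size_enum_ord.
move=> _ /mapP[k _ ->]; rewrite /F; have n0 : 0 < n.+1%:R :> R by rewrite ltr0n.
have k0 : 0 < k.+1%:R / n.+1%:R :> R by rewrite divr_gt0 ?ltr0n.
have k1 : k.+1%:R / n.+1%:R < 1 :> R by rewrite ltr_pdivrMr// mul1r ltr_nat ltnS.
by rewrite ltrDl mulr_gt0 ?subr_gt0//= -ltrBrDl gtr_pMr ?subr_gt0.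
Qed.

Theorem generic_fibre (E X : finType) d
    (phi : E -> {ffun X -> R} -> R) (phiq : E -> {ffun X -> rat} -> rat)
    (lo hi : E -> R) :
    (#|X| <= #|E|)%N -> (forall e, sep_poly d (phi e)) ->
    (forall e (x : {ffun X -> rat}),
      phi e [ffun i => ratr (x i)] = ratr (phiq e x)) ->
    (forall e, lo e < hi e) ->
  exists (N : X -> nat) (Q : X -> nat -> mpoly.mpoly #|E| rat),
    (forall (x : {ffun X -> R}) i,
      \sum_(k < N i) rat_eval (Q i k) (fun e => phi e x) * x i ^+ k = 0) /\
    exists z : E -> R, (forall e, lo e < z e < hi e) /\
      forall i, exists k : 'I_(N i), rat_eval (Q i k) z != 0.
Proof.
move=> XE phiP phiE lohi.
(* The coordinate [x i] joins the functions [phi e] as the index [None], which makes more functions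
   than variables. *)
have dep i : exists N (v : {ffun {ffun option E -> 'I_N} -> rat})
    (g : {ffun option E -> 'I_N}), v g != 0 /\
    forall x : {ffun X -> R}, lagr_eval v (option_cons (x i) (fun e => phi e x)) = 0.
  pose psi (j : option E) (x : {ffun X -> R}) := if j is Some e then phi e x else x i.
  pose psiq (j : option E) (x : {ffun X -> rat}) := if j is Some e then phiq e x else x i.
  have [||j x|N [v [g [vg H]]]] := @algebraic_dependency R _ X d.+1 psi psiq.
  - by rewrite card_option ltnS.
  - move=> [e|] /=; first exact: sep_poly_le (phiP e).
    by apply: sep_poly_le (sep_poly_proj i).
  - by case: j => [e|] /=; rewrite ?phiE// ffunE.
  exists N, v, g; split; first by [].
  move=> x.
  suff -> : option_cons (x i) (phi^~ x) = [ffun j => psi j x] by exact: H.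
  by apply/ffunP => -[e|]; rewrite !ffunE.
have /fin_all_exists[N H1] := dep; have /fin_all_exists[v H2] := H1.
have /fin_all_exists[g Hg] := H2.
exists N, (fun i => fibre_coef (v i)); split=> [x i|].
  by rewrite -lagr_eval_cons; have [_ ->] := Hg i.
pose D := (\max_i #|{: option E}| * (1 * N i))%N.
have /fin_all_exists[S SP] : forall j : option E, exists s : seq R,
    [/\ uniq s, size s = (#|X| * D).+1 &
        {in s, forall t, if j is Some e then lo e < t < hi e else 0 < t < 1}].
  move=> [e|]; first exact: interval_points.
  exact: (interval_points _ ltr01).
(* One point where no relation vanishes, the unknown being treated as independent of the lengths.
   Its component [None], confined to (0, 1), is dropped afterwards; what remains is a length vector
   where every relation keeps a nonzero coefficient. *)
have [||||z zS zP] := @common_nonzero R (option E) X D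
  (fun i y => lagr_eval (v i) y) (fun i => [ffun j => (g i j)%:R]) S.
- move=> i; apply: (@sep_poly_le _ _ (#|{: option E}| * (1 * N i))).
    exact: leq_bigmax.
  apply: (@sep_poly_ext _ _ _ (fun x => lagr_eval (v i) [ffun j => x j])).
    by move=> x; congr (lagr_eval _ _); apply/ffunP => j; rewrite ffunE.
  by apply: sep_poly_lagr_eval => j; apply: sep_poly_proj.
- by move=> j; have [] := SP j.
- by move=> j; have [_ ->] := SP j.
- move=> i; rewrite lagr_eval_grid; have [vg _] := Hg i.
  by rewrite fmorph_eq0.
exists (fun e => z (Some e)); split=> [e|i].
  by have [_ _ /(_ _ (zS (Some e)))] := SP (Some e).
apply/existsP; apply: contraT; rewrite negb_exists => /forallP Q0.
have := zP i; have -> : z = option_cons (z None) (fun e => z (Some e)).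
  by apply/ffunP => -[e|]; rewrite ffunE.
rewrite lagr_eval_cons big1 ?eqxx// => k _.
by have /negPn/eqP -> := Q0 k; rewrite mul0r.
Qed.
End GenericFibre.

(** * Points and frames *)

Section Geometry.
Context (R : realFieldType).

Definition point : Type := R * R * R.
Implicit Types (p q o a b c d x y z : point).

Definition sub3 p q : point := (p.1.1 - q.1.1, p.1.2 - q.1.2, p.2 - q.2).
Definition dot3 p q : R := p.1.1 * q.1.1 + p.1.2 * q.1.2 + p.2 * q.2.
Definition cross3 p q : point :=
  (p.1.2 * q.2 - p.2 * q.1.2, p.2 * q.1.1 - p.1.1 * q.2,
   p.1.1 * q.1.2 - p.1.2 * q.1.1).
Definition dist2 p q : R :=
  (p.1.1 - q.1.1) ^+ 2 + (p.1.2 - q.1.2) ^+ 2 + (p.2 - q.2) ^+ 2.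
Definition det3 p q r := dot3 (cross3 p q) r.

(* [w] stands for the coordinates in the frame [e1, e2, e1 x e2]. *)
Definition frame (a b c : point) (w : point) : point :=
  let e1 := sub3 b a in let e2 := sub3 c a in let n := cross3 e1 e2 in
  (a.1.1 + w.1.1 * e1.1.1 + w.1.2 * e2.1.1 + w.2 * n.1.1,
   a.1.2 + w.1.1 * e1.1.2 + w.1.2 * e2.1.2 + w.2 * n.1.2,
   a.2 + w.1.1 * e1.2 + w.1.2 * e2.2 + w.2 * n.2).

Definition gram2 (l1 l2 g : R) : R := l1 * l2 - g ^+ 2.

(** Squared length of the vector with coordinates [w] in the frame: [l1], [g], [l2] form the Gram
    matrix of the two sides, and the cross product is orthogonal to both, with squared length
    [gram2]. *)
Definition quad (l1 l2 g : R) (w : point) : R :=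
  w.1.1 ^+ 2 * l1 + 2 * (w.1.1 * w.1.2) * g + w.1.2 ^+ 2 * l2 +
  w.2 ^+ 2 * gram2 l1 l2 g.

(* Inner product of [b - a] and [c - a] from the squared side lengths. *)
Definition polar (l1 l2 l12 : R) : R := (l1 + l2 - l12) / 2.

Definition tri_gram a b c : R :=
  gram2 (dist2 a b) (dist2 a c) (polar (dist2 a b) (dist2 a c) (dist2 b c)).

Definition coords (a b c : point) (x : point) : point :=
  let e1 := sub3 b a in let e2 := sub3 c a in let w := sub3 x a in
  let D := tri_gram a b c in
  ((dist2 a c * dot3 w e1 - dot3 e1 e2 * dot3 w e2) / D,
   (dist2 a b * dot3 w e2 - dot3 e1 e2 * dot3 w e1) / D,
   det3 e1 e2 w / D).

Arguments coords : simpl never.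

Lemma dist2C p q : dist2 p q = dist2 q p.
Proof. by rewrite /dist2; ring. Qed.

Lemma dist2_ge0 p q : 0 <= dist2 p q.
Proof. by rewrite !addr_ge0 ?sqr_ge0. Qed.

Lemma polar_dot a b c :
  polar (dist2 a b) (dist2 a c) (dist2 b c) = dot3 (sub3 b a) (sub3 c a).
Proof. by rewrite /polar /dist2 /dot3 /sub3 /=; field. Qed.

Lemma frame_dist2 a b c v w :
  dist2 (frame a b c v) (frame a b c w) =
  quad (dist2 a b) (dist2 a c) (polar (dist2 a b) (dist2 a c) (dist2 b c))
    (sub3 v w).
Proof.
rewrite polar_dot; case: a b c v w => [[? ?] ?] [[? ?] ?] [[? ?] ?] [[? ?] ?] [[? ?] ?].
by rewrite /dist2 /quad /gram2 /dot3 /sub3 /frame /=; ring.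
Qed.

Lemma coordsK a b c x : tri_gram a b c != 0 ->
  frame a b c (coords a b c x) = x.
Proof.
rewrite /coords /tri_gram polar_dot.
case: a b c x => [[a1 a2] a3] [[b1 b2] b3] [[c1 c2] c3] [[x1 x2] x3].
rewrite /frame /det3 /dist2 /gram2 /dot3 /sub3 /cross3 /= => D0.
by congr ((_, _), _); field.
Qed.

Lemma coords_dist2 a b c x y : tri_gram a b c != 0 ->
  dist2 x y =
  quad (dist2 a b) (dist2 a c) (polar (dist2 a b) (dist2 a c) (dist2 b c))
    (sub3 (coords a b c x) (coords a b c y)).
Proof. by move=> D0; rewrite -frame_dist2 !coordsK. Qed.

Lemma frame0 a b c : frame a b c (0, 0, 0) = a.
Proof.
by case: a => [[? ?] ?]; rewrite /frame /=; congr ((_, _), _); ring.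
Qed.

Lemma frame1 a b c : frame a b c (1, 0, 0) = b.
Proof.
by case: a b => [[? ?] ?] [[? ?] ?]; rewrite /frame /=; congr ((_, _), _); ring.
Qed.

Lemma frame2 a b c : frame a b c (0, 1, 0) = c.
Proof.
by case: a c => [[? ?] ?] [[? ?] ?]; rewrite /frame /=; congr ((_, _), _); ring.
Qed.

Definition flip (s : R) (w : point) : point := (w.1.1, w.1.2, s * w.2).

Lemma quad_flip l1 l2 g s v w : s ^+ 2 = 1 ->
  quad l1 l2 g (sub3 (flip s v) (flip s w)) = quad l1 l2 g (sub3 v w).
Proof.
by move=> s1; rewrite /quad /sub3 /flip /= -mulrBr exprMn s1 mul1r.
Qed.

Lemma coords_base a b c : tri_gram a b c != 0 ->
  [/\ coords a b c a = (0, 0, 0), coords a b c b = (1, 0, 0) &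
      coords a b c c = (0, 1, 0)].
Proof.
rewrite /coords /tri_gram polar_dot.
case: a b c => [[a1 a2] a3] [[b1 b2] b3] [[c1 c2] c3].
rewrite /frame /det3 /dist2 /gram2 /dot3 /sub3 /cross3 /= => D0.
by split; congr ((_, _), _); field.
Qed.

Lemma coords_polar a b c x l1 l2 g u v : tri_gram a b c != 0 ->
    l1 = dist2 a b -> l2 = dist2 a c -> g = polar l1 l2 (dist2 b c) ->
    u = polar (dist2 a x) l1 (dist2 x b) ->
    v = polar (dist2 a x) l2 (dist2 x c) ->
  [/\ (coords a b c x).1.1 = (l2 * u - g * v) / gram2 l1 l2 g,
      (coords a b c x).1.2 = (l1 * v - g * u) / gram2 l1 l2 g &
      quad l1 l2 g (coords a b c x) = dist2 a x].
Proof.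
move=> D0 -> -> -> -> ->; rewrite !polar_dot; split.
- by rewrite /coords /tri_gram /= polar_dot.
- by rewrite /coords /tri_gram /= polar_dot.
have [ca _ _] := coords_base D0.
rewrite [dist2 a x]dist2C [RHS](coords_dist2 _ _ D0) ca -polar_dot.
by case: (coords a b c x) => [[p q] r]; rewrite /quad /sub3 /= !subr0.
Qed.

(** In the frame of the first three points, the distances determine two coordinates of the fourth
    and the square of its third. The two fourth points thus agree up to [flip], and [phi] combines
    the change of frame with that possible reflection; it may reverse orientation. *)
Lemma transfer a b c d a' b' c' d' : tri_gram a b c != 0 ->
    dist2 a' b' = dist2 a b -> dist2 a' c' = dist2 a c ->
    dist2 b' c' = dist2 b c -> dist2 a' d' = dist2 a d ->
    dist2 b' d' = dist2 b d -> dist2 c' d' = dist2 c d ->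
  exists phi : point -> point,
    (forall x y, dist2 (phi x) (phi y) = dist2 x y) /\
    [/\ phi a = a', phi b = b', phi c = c' & phi d = d'].
Proof.
move=> D0 ab ac bc ad bd cd.
have D0' : tri_gram a' b' c' != 0 by rewrite /tri_gram ab ac bc.
have [ha hb hc] := coords_base D0.
have [d1 d2 d3] := coords_polar (x := d) D0 erefl erefl erefl erefl erefl.
have [] := coords_polar (x := d') D0' erefl erefl erefl erefl erefl.
rewrite ab ac bc ad [dist2 d' _]dist2C bd [dist2 d' _]dist2C cd.
rewrite [dist2 b d]dist2C [dist2 c d]dist2C -d1 -d2 => e1 e2 e3.
rewrite -d3 in e3.
have [s s1 sd] : exists2 s : R, s ^+ 2 = 1 &
    coords a' b' c' d' = flip s (coords a b c d).
  move: e1 e2 e3; case: (coords a' b' c' d') => [[x y] z].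
  case: (coords a b c d) => [[x' y'] z']; cbn [fst snd] => -> ->; rewrite /quad /= => /addrI.
  move/(mulIf D0)/eqP; rewrite eqf_sqr => /orP[] /eqP ->.
    by exists 1; rewrite ?expr1n// /flip /= mul1r.
  by exists (-1); rewrite ?sqrrN ?expr1n// /flip /= mulN1r.
exists (fun x => frame a' b' c' (flip s (coords a b c x))); split=> [x y|].
  by rewrite frame_dist2 quad_flip// ab ac bc -(coords_dist2 _ _ D0).
rewrite ha hb hc -sd coordsK// /flip /= !mulr0.
by rewrite frame0 frame1 frame2.
Qed.
Lemma tri_gram_cross a b c :
  tri_gram a b c = dot3 (cross3 (sub3 b a) (sub3 c a)) (cross3 (sub3 b a) (sub3 c a)).
Proof.
rewrite /tri_gram polar_dot.
by rewrite /gram2 /dot3 /cross3 /dist2 /sub3 /=; ring.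
Qed.

Lemma det3_tri_gram a b c d :
  det3 (sub3 b a) (sub3 c a) d != 0 -> tri_gram a b c != 0.
Proof.
apply: contra_neq; rewrite tri_gram_cross /det3.
case: (cross3 _ _) => [[x y] z]; rewrite /dot3 /= -!expr2 => /eqP.
rewrite paddr_eq0 ?addr_ge0 ?sqr_ge0// paddr_eq0 ?sqr_ge0// !sqrf_eq0.
by move=> /andP[/andP[/eqP -> /eqP ->] /eqP ->]; rewrite !mul0r !addr0.
Qed.

End Geometry.

(** * Chains of tetrahedra around an axis *)

(* [chain_closure] is evaluated both on real numbers and on intervals. *)
Record arith (T : Type) := Arith {
  aadd : T -> T -> T; asub : T -> T -> T; amul : T -> T -> T; asqr : T -> T;
  ahalf : T -> T; ainv : T -> T; asqrt : T -> T; aneg : T -> T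
}.

(* Squared lengths of a chain of vertices 1, 2, 3, 4 around an axis PQ:
   [cp i] and [cq i] are those from vertex i to P and Q, and [cm i] is that
   from vertex i to vertex i + 1. *)
Record chain (T : Type) := Chain {
  cp1 : T; cq1 : T; cp2 : T; cq2 : T; cp3 : T; cq3 : T; cp4 : T; cq4 : T;
  cm1 : T; cm2 : T; cm3 : T
}.

Section ChainClosure.
Variables (T : Type) (A : arith T).
Local Notation "x + y" := (aadd A x y).
Local Notation "x - y" := (asub A x y).
Local Notation "x * y" := (amul A x y).
Local Notation sqr := (asqr A).

Definition inner_link (r r' y y' m w : T) : T :=
  ahalf A (r + r' + sqr (y - y') * w - m).
Definition signed (s : bool) (x : T) : T := if s then aneg A x else x.

(* With [t] the squared length of PQ, the squared distance between vertices 1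
   and 4, for the given orientations of the three tetrahedra on PQ. The list
   gathers what must be positive: 4 t, the squared distances to the axis, the
   squared normalised volumes, and a denominator. *)
Definition chain_closure (c : chain T) (s1 s2 s3 : bool) (t : T) : seq T * T :=
  let t4 := t + t + (t + t) in
  let w := ainv A t4 in
  let y1 := cp1 c - cq1 c + t in
  let y2 := cp2 c - cq2 c + t in
  let y3 := cp3 c - cq3 c + t in
  let y4 := cp4 c - cq4 c + t in
  let r1 := cp1 c - sqr y1 * w in
  let r2 := cp2 c - sqr y2 * w in
  let r3 := cp3 c - sqr y3 * w in
  let r4 := cp4 c - sqr y4 * w in
  let n1 := inner_link r1 r2 y1 y2 (cm1 c) w in
  let n2 := inner_link r2 r3 y2 y3 (cm2 c) w in
  let n3 := inner_link r3 r4 y3 y4 (cm3 c) w in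
  let d1 := r1 * r2 - sqr n1 in
  let d2 := r2 * r3 - sqr n2 in
  let d3 := r3 * r4 - sqr n3 in
  let q1 := signed s1 (asqrt A d1) in
  let q2 := signed s2 (asqrt A d2) in
  let q3 := signed s3 (asqrt A d3) in
  let e := (n1 * n2 - q1 * q2) * n3 - (q1 * n2 + q2 * n1) * q3 in
  let den := r2 * r3 in
  ([:: t4; r1; r2; r3; r4; d1; d2; d3; den],
   r1 + r4 + sqr (y1 - y4) * w - (e + e) * ainv A den).
End ChainClosure.

Section ChainGeometry.
Context (R : realFieldType).

(** Multiplication of [a + i b] by [(n + i q) / r]. In the plane orthogonal to the axis this turns
    one vertex of the chain into the next: [n] and [q] are the inner product and the oriented area
    of their projections, [r] and [r'] the squared lengths. *)
Lemma turn_step (r r' n q a b : R) : r != 0 -> a ^+ 2 + b ^+ 2 = r ->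
  n ^+ 2 + q ^+ 2 = r * r' ->
  let a' := (a * n - b * q) / r in let b' := (a * q + b * n) / r in
  a' ^+ 2 + b' ^+ 2 = r' /\ a * a' + b * b' = n.
Proof.
move=> r0 ab nq a' b'; split.
  have -> : a' ^+ 2 + b' ^+ 2 = (a ^+ 2 + b ^+ 2) * (n ^+ 2 + q ^+ 2) / r ^+ 2.
    by rewrite /a' /b'; field.
  by rewrite ab nq; field.
have -> : a * a' + b * b' = (a ^+ 2 + b ^+ 2) * n / r by rewrite /a' /b'; field.
by rewrite ab; field.
Qed.

(** The coordinate along the axis is [y / (2 * h)]: the difference of the squared distances to both
    ends of the axis is affine in it. *)
Lemma axis_dist2 (h t p q y r a b : R) : h != 0 -> h ^+ 2 = t ->
    y = p - q + t -> r = p - y ^+ 2 / (4 * t) -> a ^+ 2 + b ^+ 2 = r ->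
  dist2 (0, 0, 0) (y / (2 * h), a, b) = p /\
  dist2 (h, 0, 0) (y / (2 * h), a, b) = q.
Proof.
move=> h0 ht yE rE ab; have t0 : t != 0 by rewrite -ht expf_neq0.
have -> : dist2 (0, 0, 0) (y / (2 * h), a, b) = y ^+ 2 / (4 * t) + (a ^+ 2 + b ^+ 2).
  by rewrite /dist2 /= -ht; field.
have -> : dist2 (h, 0, 0) (y / (2 * h), a, b) =
    y ^+ 2 / (4 * t) - y + t + (a ^+ 2 + b ^+ 2).
  by rewrite /dist2 /= -ht; field.
by rewrite ab rE yE; split; field.
Qed.

Lemma link_dist2 (h t y y' r r' a b a' b' : R) : h != 0 -> h ^+ 2 = t ->
    a ^+ 2 + b ^+ 2 = r -> a' ^+ 2 + b' ^+ 2 = r' ->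
  dist2 (y / (2 * h), a, b) (y' / (2 * h), a', b') =
  r + r' + (y - y') ^+ 2 / (4 * t) - 2 * (a * a' + b * b').
Proof. by move=> h0 <- <- <-; rewrite /dist2 /=; field. Qed.
End ChainGeometry.

Section ChainRealization.
Context (R : rcfType).

Definition real_arith : arith R := Arith (fun x y => x + y) (fun x y => x - y)
  (fun x y => x * y) (fun x => x ^+ 2) (fun x => x / 2) GRing.inv Num.sqrt
  (fun x => - x).

Lemma chain_realization (c : chain R) (s1 s2 s3 : bool) (t : R) :
    (forall x, x \in (chain_closure real_arith c s1 s2 s3 t).1 -> 0 < x) ->
  exists P Q v1 v2 v3 v4 : point R,
    [/\ dist2 P Q = t,
        [/\ dist2 P v1 = cp1 c, dist2 P v2 = cp2 c, dist2 P v3 = cp3 c &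
            dist2 P v4 = cp4 c],
        [/\ dist2 Q v1 = cq1 c, dist2 Q v2 = cq2 c, dist2 Q v3 = cq3 c &
            dist2 Q v4 = cq4 c],
        [/\ dist2 v1 v2 = cm1 c, dist2 v2 v3 = cm2 c, dist2 v3 v4 = cm3 c &
            dist2 v1 v4 = (chain_closure real_arith c s1 s2 s3 t).2] &
        det3 (sub3 Q P) (sub3 v1 P) (sub3 v2 P) != 0].
Proof.
rewrite /chain_closure /=.
set w := (t + t + (t + t))^-1.
have wE : w = (4 * t)^-1 by rewrite /w; congr (_^-1); ring.
set y1 := cp1 c - cq1 c + t; set y2 := cp2 c - cq2 c + t.
set y3 := cp3 c - cq3 c + t; set y4 := cp4 c - cq4 c + t.
set r1 := cp1 c - y1 ^+ 2 * w; set r2 := cp2 c - y2 ^+ 2 * w.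
set r3 := cp3 c - y3 ^+ 2 * w; set r4 := cp4 c - y4 ^+ 2 * w.
rewrite /inner_link /=.
set n1 := (r1 + r2 + _ - _) / 2; set n2 := (r2 + r3 + _ - _) / 2.
set n3 := (r3 + r4 + _ - _) / 2.
set d1 := r1 * r2 - _; set d2 := r2 * r3 - _; set d3 := r3 * r4 - _.
set q1 := signed _ s1 _; set q2 := signed _ s2 _; set q3 := signed _ s3 _.
move=> pos.
have t0 : 0 < t.
  have : 0 < t + t + (t + t) by apply: pos; rewrite inE eqxx.
  by lra.
have [r10 r20 r30] : [/\ r1 > 0, r2 > 0 & r3 > 0].
  by split; apply: pos; rewrite !inE eqxx ?orbT.
have [d10 d20 d30] : [/\ d1 > 0, d2 > 0 & d3 > 0].
  by split; apply: pos; rewrite !inE eqxx ?orbT.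
have qE s d : 0 < d -> signed real_arith s (Num.sqrt d) ^+ 2 = d.
  by move=> d0; case: s; rewrite /= ?sqrrN sqr_sqrtr ?ltW.
have e1 : n1 ^+ 2 + q1 ^+ 2 = r1 * r2 by rewrite qE// /d1; ring.
have e2 : n2 ^+ 2 + q2 ^+ 2 = r2 * r3 by rewrite qE// /d2; ring.
have e3 : n3 ^+ 2 + q3 ^+ 2 = r3 * r4 by rewrite qE// /d3; ring.
pose h := Num.sqrt t; pose rho := Num.sqrt r1.
have ht : h ^+ 2 = t by rewrite sqr_sqrtr ?ltW.
have h0 : h != 0 by rewrite gt_eqF ?sqrtr_gt0.
have rhoE : rho ^+ 2 + 0 ^+ 2 = r1 by rewrite expr0n addr0 sqr_sqrtr ?ltW.
have [z2 i1] := turn_step (lt0r_neq0 r10) rhoE e1.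
have [z3 i2] := turn_step (lt0r_neq0 r20) z2 e2.
have [z4 i3] := turn_step (lt0r_neq0 r30) z3 e3.
set a2 := (_ / r1) in z2 i1 z3 i2 z4 i3.
set b2 := (_ / r1) in z2 i1 z3 i2 z4 i3.
set a3 := (_ / r2) in z3 i2 z4 i3; set b3 := (_ / r2) in z3 i2 z4 i3.
set a4 := (_ / r3) in z4 i3; set b4 := (_ / r3) in z4 i3.
have r1E : r1 = cp1 c - y1 ^+ 2 / (4 * t) by rewrite -wE.
have r2E : r2 = cp2 c - y2 ^+ 2 / (4 * t) by rewrite -wE.
have r3E : r3 = cp3 c - y3 ^+ 2 / (4 * t) by rewrite -wE.
have r4E : r4 = cp4 c - y4 ^+ 2 / (4 * t) by rewrite -wE.
have [P1 Q1] := axis_dist2 h0 ht erefl r1E rhoE.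
have [P2 Q2] := axis_dist2 h0 ht erefl r2E z2.
have [P3 Q3] := axis_dist2 h0 ht erefl r3E z3.
have [P4 Q4] := axis_dist2 h0 ht erefl r4E z4.
exists (0, 0, 0), (h, 0, 0), (y1 / (2 * h), rho, 0), (y2 / (2 * h), a2, b2),
  (y3 / (2 * h), a3, b3), (y4 / (2 * h), a4, b4).
split=> //.
- by rewrite /dist2 /= -ht; ring.
- split.
  + by rewrite (link_dist2 _ _ h0 ht rhoE z2) i1 /n1 wE; field; rewrite gt_eqF.
  + by rewrite (link_dist2 _ _ h0 ht z2 z3) i2 /n2 wE; field; rewrite gt_eqF.
  + by rewrite (link_dist2 _ _ h0 ht z3 z4) i3 /n3 wE; field; rewrite gt_eqF.
  rewrite (link_dist2 _ _ h0 ht rhoE z4).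
  (* Vertex 1 lies at angle 0, so its inner product with vertex 4 is the real part of the product of
     the three [n + i q], up to the denominator. *)
  suff -> : rho * a4 + 0 * b4 =
      ((n1 * n2 - q1 * q2) * n3 - (q1 * n2 + q2 * n1) * q3) / (r2 * r3).
    by rewrite wE; ring.
  rewrite mul0r addr0.
  have -> : rho * a4 = rho ^+ 2 *
      ((n1 * n2 - q1 * q2) * n3 - (q1 * n2 + q2 * n1) * q3) / (r1 * r2 * r3).
    by rewrite /a4 /a3 /b3 /a2 /b2; field; rewrite ?(gt_eqF r10) ?(gt_eqF r20) ?(gt_eqF r30).
  have -> : rho ^+ 2 = r1 by rewrite -rhoE expr0n addr0.
  by field; rewrite ?(gt_eqF r10) ?(gt_eqF r20) ?(gt_eqF r30).
(* The determinant reduces to [h * q1], and [q1 ^+ 2 = d1] is positive. *)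
have -> : det3 (sub3 (h, 0, 0) (0, 0, 0))
    (sub3 (y1 / (2 * h), rho, 0) (0, 0, 0)) (sub3 (y2 / (2 * h), a2, b2) (0, 0, 0)) =
    h * (rho ^+ 2 / r1) * q1.
  by rewrite /det3 /cross3 /dot3 /sub3 /= /b2; field; rewrite (gt_eqF r10) h0.
have -> : rho ^+ 2 = r1 by rewrite -rhoE expr0n addr0.
rewrite divff ?(gt_eqF r10)// mulr1 mulf_neq0//.
by rewrite -sqrf_eq0 qE// gt_eqF.
Qed.
End ChainRealization.

Definition disphenoid_edges : seq (nat * nat) :=
  [:: (0, 1); (0, 2); (1, 2); (1, 3); (3, 4); (0, 4); (2, 4); (1, 5); (5, 4);
      (2, 5); (5, 3); (0, 7); (7, 3); (0, 6); (6, 3); (1, 7); (7, 6); (6, 4)]%N.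

(* The vertices 0, 3 and 1, 4 are the two non-adjacent pairs of vertices of
   degree five: the chain 0, 2, 5, 3 turns around the axis 1-4 and the chain
   1, 7, 6, 4 around the axis 0-3. *)
Definition chain03 (T : Type) (l : nat -> T) : chain T :=
  Chain (l 0) (l 5) (l 2) (l 6) (l 7) (l 8) (l 3) (l 4) (l 1) (l 9) (l 10).
Definition chain14 (T : Type) (l : nat -> T) : chain T :=
  Chain (l 0) (l 3) (l 11) (l 12) (l 13) (l 14) (l 5) (l 4) (l 15) (l 16) (l 17).

Section Disphenoid.
Context (R : rcfType).

(** The two chains share the tetrahedron 0, 1, 3, 4. Four of its edges belong to the graph, and the
    two closure conditions equate the other two lengths, so an isometry carries the second chain
    onto the first along this tetrahedron. *)
Lemma disphenoid_realization (l : nat -> R) (s1 s2 s3 s1' s2' s3' : bool) (t : R) :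
    let B := chain_closure (real_arith R) (chain03 l) s1 s2 s3 t in
    let A := chain_closure (real_arith R) (chain14 l) s1' s2' s3' B.2 in
    (forall x, x \in B.1 -> 0 < x) -> (forall x, x \in A.1 -> 0 < x) ->
    A.2 = t ->
  exists q : nat -> point R,
    [/\ forall e, (e < 18)%N -> let uv := nth (0, 0)%N disphenoid_edges e in
          dist2 (q uv.1) (q uv.2) = l e,
        dist2 (q 1) (q 4) = t, dist2 (q 0) (q 3) = B.2 &
        det3 (sub3 (q 1) (q 0)) (sub3 (q 2) (q 0)) (sub3 (q 4) (q 0)) != 0].
Proof.
move=> B A Bpos Apos At.
have [c2 [c4 [c1 [b1 [b2 [c3 []]]]]]] := chain_realization Bpos.
rewrite -/B /= => c24 [c21 c2b1 c2b2 c23] [c41 c4b1 c4b2 c43].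
move=> [c1b1 b1b2 b2c3 c13] det.
have [C1 [C3 [C2 [a2 [a1 [C4 []]]]]]] := chain_realization Apos.
rewrite -/A At /= => C13 [C12 C1a2 C1a1 C14] [C32 C3a2 C3a1 C34].
move=> [C2a2 a2a1 a1C4 C24] /det3_tri_gram D0.
have [phi [phiI [phi1 phi3 phi2 phi4]]] : exists phi : point R -> point R,
    (forall x y, dist2 (phi x) (phi y) = dist2 x y) /\
    [/\ phi C1 = c1, phi C3 = c3, phi C2 = c2 & phi C4 = c4].
  apply: transfer => //.
  - by rewrite c13 C13.
  - by rewrite dist2C c21 C12.
  - by rewrite dist2C c23 C32.
  - by rewrite dist2C c41 C14.
  - by rewrite dist2C c43 C34.
  - by rewrite c24 C24.
exists (nth c1 [:: c1; c2; b1; c3; c4; b2; phi a1; phi a2]); split=> //.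
- do 18 (case=> [_|] /=; first
    by rewrite -?phi1 -?phi2 -?phi3 -?phi4 ?phiI // ?phi1 ?phi2 ?phi3 ?phi4 // dist2C).
  by [].
- move: det; apply: contra_neq => /= det0; rewrite -[RHS]oppr0 -det0.
  by rewrite /det3 /cross3 /dot3 /sub3 /=; ring.
Qed.
End Disphenoid.

(** * Interval arithmetic *)

(* Intervals with endpoints in units of [2 ^ -32]. *)
Definition ival : Type := Z * Z.

Section IntervalArithmetic.
Local Open Scope Z_scope.
Implicit Types a b : ival.

Definition prec : Z := 32.
Definition round_down (z : Z) : Z := Z.shiftr z prec.
Definition round_up (z : Z) : Z := - Z.shiftr (- z) prec.

Definition ival_add a b : ival := (a.1 + b.1, a.2 + b.2).
Definition ival_sub a b : ival := (a.1 - b.2, a.2 - b.1).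
Definition ival_neg a : ival := (- a.2, - a.1).
Definition ival_mul a b : ival :=
  if (0 <=? a.1) && (0 <=? b.1) then
    (round_down (a.1 * b.1), round_up (a.2 * b.2))
  else
    let x := a.1 * b.1 in let y := a.1 * b.2 in
    let z := a.2 * b.1 in let t := a.2 * b.2 in
    (round_down (Z.min (Z.min x y) (Z.min z t)),
     round_up (Z.max (Z.max x y) (Z.max z t))).
Definition ival_sqr a : ival :=
  if 0 <=? a.1 then (round_down (a.1 * a.1), round_up (a.2 * a.2))
  else if a.2 <=? 0 then (round_down (a.2 * a.2), round_up (a.1 * a.1))
  else (0, round_up (Z.max (a.1 * a.1) (a.2 * a.2))).
Definition ival_half a : ival := (Z.shiftr a.1 1, - Z.shiftr (- a.2) 1).
Definition ival_inv a : ival :=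
  (Z.div (2 ^ (2 * prec)) a.2, - Z.div (- 2 ^ (2 * prec)) a.1).
Definition ival_sqrt a : ival :=
  (Z.sqrt (Z.shiftl a.1 prec), Z.sqrt (Z.shiftl a.2 prec) + 1).
End IntervalArithmetic.

Definition ival_arith : arith ival := Arith ival_add ival_sub ival_mul ival_sqr
  ival_half ival_inv ival_sqrt ival_neg.

Section IntervalSoundness.
Context (R : rcfType).
Implicit Types (z : Z) (x y : R) (a b : ival).

Definition zr z : R := (int_of_Z z)%:~R.

Lemma zrD z z' : zr (z + z') = zr z + zr z'.
Proof. by rewrite /zr -rmorphD -[in RHS]rmorphD. Qed.
Lemma zrN z : zr (- z) = - zr z.
Proof. by rewrite /zr -rmorphN -[in RHS]rmorphN. Qed.
Lemma zrB z z' : zr (z - z') = zr z - zr z'.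
Proof. by rewrite zrD zrN. Qed.
Lemma zrM z z' : zr (z * z') = zr z * zr z'.
Proof. by rewrite /zr -rmorphM -[in RHS]rmorphM. Qed.
Lemma zr_le z z' : Z.le z z' -> zr z <= zr z'.
Proof. by move=> zz'; rewrite /zr ler_int; lia. Qed.
Lemma zr_lt z z' : Z.lt z z' -> zr z < zr z'.
Proof. by move=> zz'; rewrite /zr ltr_int; lia. Qed.

Lemma zr0 : zr 0 = 0. Proof. by []. Qed.
Lemma zr1 : zr 1 = 1. Proof. by []. Qed.
Lemma zr2 : zr 2 = 2. Proof. by []. Qed.
Lemma zr_nat n : zr (Z.of_nat n) = n%:R.
Proof.
elim: n => [|n IHn]; first by rewrite zr0.
by rewrite Nat2Z.inj_succ zrD IHn zr1 -natr1.
Qed.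

Lemma zr_ge0 z : Z.le 0 z -> 0 <= zr z.
Proof. by move/zr_le; rewrite zr0. Qed.
Opaque zr.

(* Opaque, since unfolding [zr (2 ^ prec)] yields a unary natural number. *)
Fact scale_subproof : {s : R | s = zr (2 ^ prec)}.
Proof. by exists (zr (2 ^ prec)). Qed.
Definition scale : R := sval scale_subproof.
Lemma scaleE : scale = zr (2 ^ prec).
Proof. exact: (svalP scale_subproof). Qed.

Lemma scale_gt0 : 0 < scale.
Proof. by rewrite scaleE -zr0; apply: zr_lt. Qed.

Lemma round_downP z : zr (round_down z) * scale <= zr z.
Proof.
rewrite scaleE -zrM; apply: zr_le; rewrite /round_down Z.shiftr_div_pow2//.
by have := Z.mul_div_le z (2 ^ prec); rewrite /prec; lia.
Qed.

Lemma round_upP z : zr z <= zr (round_up z) * scale.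
Proof.
have := round_downP (- z); rewrite zrN => H.
by rewrite /round_up zrN mulNr -lerN2 opprK.
Qed.

Definition ival_in x a := zr a.1 <= x * scale <= zr a.2.

Lemma ival_addP x y a b : ival_in x a -> ival_in y b ->
  ival_in (x + y) (ival_add a b).
Proof.
rewrite /ival_in /= !zrD mulrDl => /andP[? ?] /andP[? ?].
by rewrite !lerD.
Qed.

Lemma ival_negP x a : ival_in x a -> ival_in (- x) (ival_neg a).
Proof.
by rewrite /ival_in /= !zrN mulNr !lerN2 andbC.
Qed.

Lemma ival_subP x y a b : ival_in x a -> ival_in y b ->
  ival_in (x - y) (ival_sub a b).
Proof.
rewrite /ival_in /= !zrB mulrBl => /andP[? ?] /andP[? ?].
by apply/andP; split; exact: lerB.
Qed.

Lemma ival_of_scaled x lo hi : zr lo <= x * scale * scale <= zr hi ->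
  ival_in x (round_down lo, round_up hi).
Proof.
move=> /andP[lx xh]; have s0 := scale_gt0; apply/andP; split => /=.
  by rewrite -(ler_pM2r s0) (le_trans (round_downP _)).
by rewrite -(ler_pM2r s0) (le_trans xh) ?round_upP.
Qed.

Lemma ival_mulP x y a b : ival_in x a -> ival_in y b ->
  ival_in (x * y) (ival_mul a b).
Proof.
move=> /andP[ax xa] /andP[byy yb]; rewrite /ival_mul.
have E : x * y * scale * scale = (x * scale) * (y * scale) by ring.
case: ifP => [/andP[/Z.leb_le a0 /Z.leb_le b0]|_].
  apply: ival_of_scaled; rewrite E !zrM.
  have a0' := zr_le a0; have b0' := zr_le b0; rewrite zr0 in a0' b0'.
  by rewrite !ler_pM// (le_trans _ ax, le_trans _ byy).
apply: ival_of_scaled; rewrite E.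
set X := x * scale in ax xa *; set Y := y * scale in byy yb *.
set m := Z.min _ _; set M := Z.max _ _.
(* A product is affine in each factor, so its extremes over a rectangle occur at the corners: [lo]
   treats the corners, [aux] frees the first factor, and the end of the proof frees the second. *)
have lo z1 z2 : ((z1 = a.1) \/ (z1 = a.2)) -> ((z2 = b.1) \/ (z2 = b.2)) ->
    zr m <= zr z1 * zr z2 <= zr M.
  by move=> h1 h2; rewrite -zrM !zr_le // /m /M; case: h1 => ->; case: h2 => ->; lia.
have aux z2 : (z2 = b.1) \/ (z2 = b.2) -> zr m <= X * zr z2 <= zr M.
  move=> h2; have /andP[l1 u1] := lo a.1 z2 (or_introl erefl) h2.
  have /andP[l2 u2] := lo a.2 z2 (or_intror erefl) h2.
  have [z0|z0] := lerP 0 (zr z2); apply/andP; split.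
  - by rewrite (le_trans l1)// ler_wpM2r.
  - by rewrite (le_trans _ u2)// ler_wpM2r.
  - by rewrite (le_trans l2)// ler_wnM2r// ltW.
  - by rewrite (le_trans _ u1)// ler_wnM2r// ltW.
have /andP[l1 u1] := aux b.1 (or_introl erefl).
have /andP[l2 u2] := aux b.2 (or_intror erefl).
have [x0|x0] := lerP 0 X; apply/andP; split.
- by rewrite (le_trans l1)// ler_wpM2l.
- by rewrite (le_trans _ u2)// ler_wpM2l.
- by rewrite (le_trans l2)// ler_wnM2l// ltW.
- by rewrite (le_trans _ u1)// ler_wnM2l// ltW.
Qed.

Lemma ival_sqrP x a : ival_in x a -> ival_in (x ^+ 2) (ival_sqr a).
Proof.
move=> /andP[ax xa]; rewrite /ival_sqr.
have E : x ^+ 2 * scale * scale = (x * scale) ^+ 2 by ring.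
set X := x * scale in ax xa E *.
case: ifP => [/Z.leb_le/zr_le a0|_].
  by apply: ival_of_scaled; rewrite E !zrM -!expr2; rewrite zr0 in a0; nra.
case: ifP => [/Z.leb_le/zr_le a0|_].
  by apply: ival_of_scaled; rewrite E !zrM -!expr2; rewrite zr0 in a0; nra.
have -> : Z0 = round_down 0 by []; apply: ival_of_scaled; rewrite E zr0 sqr_ge0 /=.
have [X0|X0] := lerP 0 X.
  apply: (@le_trans _ _ (zr (a.2 * a.2))); last by apply: zr_le; lia.
  by rewrite zrM expr2; nra.
apply: (@le_trans _ _ (zr (a.1 * a.1))); last by apply: zr_le; lia.
by rewrite zrM expr2; nra.
Qed.

Lemma half_downP z : zr (Z.shiftr z 1) * 2 <= zr z.
Proof.
rewrite -zr2 -zrM; apply: zr_le; rewrite Z.shiftr_div_pow2//.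
by have := Z.mul_div_le z (2 ^ 1); lia.
Qed.

Lemma ival_halfP x a : ival_in x a -> ival_in (x / 2) (ival_half a).
Proof.
rewrite /ival_in /= zrN => /andP[ax xa].
have h1 := half_downP a.1; have h2 := half_downP (- a.2).
by rewrite zrN in h2; apply/andP; split; lra.
Qed.

Lemma ival_in_gt0 x a : Z.lt 0 a.1 -> ival_in x a -> 0 < x.
Proof.
move=> /zr_lt; rewrite zr0 => a0 /andP[ax _]; rewrite -(pmulr_lgt0 _ scale_gt0).
exact: lt_le_trans ax.
Qed.

Lemma ival_invP x a : Z.lt 0 a.1 -> ival_in x a -> ival_in x^-1 (ival_inv a).
Proof.
move=> a0 xa; have x0 := ival_in_gt0 a0 xa; have s0 := scale_gt0.
case/andP: xa => ax xa.
have a10 : 0 < zr a.1 by rewrite -zr0; exact: zr_lt.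
have a20 : 0 < zr a.2 by rewrite (lt_le_trans a10)// (le_trans ax).
have a2Z : Z.lt 0 a.2.
  by case: (Z_lt_le_dec 0 a.2) => // /zr_le; rewrite zr0 leNgt a20.
have pE : zr (2 ^ (2 * prec)) = scale * scale by rewrite scaleE -zrM.
have pw0 : Z.le 0 (2 ^ (2 * prec)) by [].
have xs0 : 0 < x * scale by rewrite mulr_gt0.
have xE : x^-1 * scale = scale * scale / (x * scale) by field; rewrite !gt_eqF.
rewrite /ival_in xE /ival_inv; move: pE pw0; generalize (Z.pow 2 (2 * prec)).
move=> pw pE pw0; cbn [fst snd]; rewrite -pE; apply/andP; split.
  rewrite ler_pdivlMr//; apply: (@le_trans _ _ (zr (pw / a.2) * zr a.2)).
    by rewrite ler_wpM2l// -zr0; apply: zr_le; apply: Z.div_pos.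
  by rewrite -zrM; apply: zr_le; rewrite Z.mul_comm; apply: Z.mul_div_le.
rewrite ler_pdivrMr// zrN.
have H : zr pw <= - zr (- pw / a.1) * zr a.1.
  rewrite mulNr -zrM -zrN; apply: zr_le.
  have := Z.mul_div_le (- pw) a.1 a0; rewrite Z.mul_comm; lia.
apply: (le_trans H); rewrite ler_wpM2l// -zrN -zr0; apply: zr_le.
have : Z.le (- pw / a.1) 0 by apply: Z.div_le_upper_bound => //; lia.
lia.
Qed.

Lemma ival_sqrtP x a : ival_in x a -> ival_in (Num.sqrt x) (ival_sqrt a).
Proof.
have s0 := scale_gt0; have s0' := ltW s0.
move=> /andP[ax xa].
have shE z : zr (Z.shiftl z prec) = zr z * scale.
  by rewrite Z.shiftl_mul_pow2// zrM scaleE.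
have sE : Num.sqrt x * scale = Num.sqrt (x * scale * scale).
  rewrite -mulrA [RHS](_ : _ = Num.sqrt (scale ^+ 2 * x)).
    by rewrite sqrtrM ?sqr_ge0// sqrtr_sqr ger0_norm// mulrC.
  by rewrite mulrC expr2.
rewrite /ival_in sE; apply/andP; split => /=.
  have [n0|n0] := Z_lt_le_dec (Z.shiftl a.1 prec) 0.
    by rewrite Z.sqrt_neg// sqrtr_ge0.
  have [h1 _] := Z.sqrt_spec _ n0; have := zr_le h1; rewrite zrM shE -expr2 => h.
  have r0 : 0 <= zr (Z.sqrt (Z.shiftl a.1 prec)).
    by rewrite -zr0; apply/zr_le/Z.sqrt_nonneg.
  rewrite -[X in X <= _]ger0_norm// -sqrtr_sqr ler_wsqrtr// (le_trans h)//.
  by rewrite ler_wpM2r.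
have r0 : 0 <= zr (Z.sqrt (Z.shiftl a.2 prec) + 1).
  by rewrite -zr0; apply/zr_le; have := Z.sqrt_nonneg (Z.shiftl a.2 prec); lia.
rewrite -[X in _ <= X]ger0_norm// -sqrtr_sqr ler_wsqrtr//.
apply: (@le_trans _ _ (zr (Z.shiftl a.2 prec))); first by rewrite shE ler_wpM2r.
have [n0|n0] := Z_lt_le_dec (Z.shiftl a.2 prec) 0.
  by rewrite (le_trans _ (sqr_ge0 _))// -zr0; apply: zr_le; lia.
have [_ h2] := Z.sqrt_spec _ n0.
by rewrite expr2 -zrM; apply/zr_le/Z.lt_le_incl.
Qed.
End IntervalSoundness.

Section ClosureSoundness.
Context (R : rcfType).

Definition chain_in (c : chain R) (C : chain ival) : Prop :=
  [/\ ival_in (cp1 c) (cp1 C) /\ ival_in (cq1 c) (cq1 C),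
      ival_in (cp2 c) (cp2 C) /\ ival_in (cq2 c) (cq2 C),
      ival_in (cp3 c) (cp3 C) /\ ival_in (cq3 c) (cq3 C),
      ival_in (cp4 c) (cp4 C) /\ ival_in (cq4 c) (cq4 C) &
      [/\ ival_in (cm1 c) (cm1 C), ival_in (cm2 c) (cm2 C) &
          ival_in (cm3 c) (cm3 C)]].

Definition ival_pos (a : ival) : bool := Z.ltb 0 a.1.

Lemma ival_posP (x : R) a : ival_pos a -> ival_in x a -> 0 < x.
Proof. by move=> /Z.ltb_lt; apply: ival_in_gt0. Qed.

(** Inclusion is propagated operation by operation through the common program; positivity of the
    lower endpoints justifies both inversions. Naming each intermediate value on both sides keeps
    the unfolded terms small. *)
Lemma chain_closureP (c : chain R) (C : chain ival) s1 s2 s3 (t : R) (T : ival) :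
    chain_in c C -> ival_in t T ->
    all ival_pos (chain_closure ival_arith C s1 s2 s3 T).1 ->
  (forall x, x \in (chain_closure (real_arith R) c s1 s2 s3 t).1 -> 0 < x) /\
  ival_in (chain_closure (real_arith R) c s1 s2 s3 t).2
    (chain_closure ival_arith C s1 s2 s3 T).2.
Proof.
move=> [[p1 q1] [p2 q2] [p3 q3] [p4 q4] [m1 m2 m3]] tT.
have signedP s (x : R) a : ival_in x a ->
    ival_in (signed (real_arith R) s x) (signed ival_arith s a).
  by case: s => // /ival_negP.
have linkP (r r' y y' m w : R) r1 r1' y1 y1' m1' w1 :
    ival_in r r1 -> ival_in r' r1' -> ival_in y y1 -> ival_in y' y1' ->
    ival_in m m1' -> ival_in w w1 ->
    ival_in (inner_link (real_arith R) r r' y y' m w)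
      (inner_link ival_arith r1 r1' y1 y1' m1' w1).
  move=> *; apply/ival_halfP/ival_subP => //; do ?apply: ival_addP => //.
  by apply: ival_mulP => //; apply/ival_sqrP/ival_subP.
rewrite /chain_closure.
set T4 := aadd ival_arith _ (aadd ival_arith _ _).
set t4 := aadd (real_arith R) _ (aadd (real_arith R) _ _).
have t4P : ival_in t4 T4 by do ?apply: ival_addP.
set W := ainv ival_arith _; set w := ainv (real_arith R) _.
cbn [all fst snd] => /and5P[/[dup] T40 /Z.ltb_lt T40' R10 R20 R30].
move=> /and5P[R40 D10 D20 D30 /andP[den0 _]].
have wP : ival_in w W by apply: ival_invP.
have yP p q P Q : ival_in p P -> ival_in q Q ->
    ival_in (aadd (real_arith R) (asub (real_arith R) p q) t)
      (aadd ival_arith (asub ival_arith P Q) T).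
  by move=> *; apply/ival_addP => //; apply: ival_subP.
have y1P := yP _ _ _ _ p1 q1; have y2P := yP _ _ _ _ p2 q2.
have y3P := yP _ _ _ _ p3 q3; have y4P := yP _ _ _ _ p4 q4.
move: R10 R20 R30 R40 D10 D20 D30 den0.
set Y1 := aadd ival_arith _ T in y1P *; set Y2 := aadd ival_arith _ T in y2P *.
set Y3 := aadd ival_arith _ T in y3P *; set Y4 := aadd ival_arith _ T in y4P *.
set y1 := aadd (real_arith R) _ t in y1P *; set y2 := aadd (real_arith R) _ t in y2P *.
set y3 := aadd (real_arith R) _ t in y3P *; set y4 := aadd (real_arith R) _ t in y4P *.
have rP p P y Y : ival_in p P -> ival_in y Y ->
    ival_in (asub (real_arith R) p (amul (real_arith R) (asqr (real_arith R) y) w))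
      (asub ival_arith P (amul ival_arith (asqr ival_arith Y) W)).
  by move=> *; apply: ival_subP => //; apply: ival_mulP => //; apply: ival_sqrP.
have r1P := rP _ _ _ _ p1 y1P; have r2P := rP _ _ _ _ p2 y2P.
have r3P := rP _ _ _ _ p3 y3P; have r4P := rP _ _ _ _ p4 y4P.
set R1 := asub ival_arith (cp1 C) _ in r1P *.
set R2 := asub ival_arith (cp2 C) _ in r2P *.
set R3 := asub ival_arith (cp3 C) _ in r3P *.
set R4 := asub ival_arith (cp4 C) _ in r4P *.
set r1 := asub (real_arith R) (cp1 c) _ in r1P *.
set r2 := asub (real_arith R) (cp2 c) _ in r2P *.
set r3 := asub (real_arith R) (cp3 c) _ in r3P *.
set r4 := asub (real_arith R) (cp4 c) _ in r4P *.
have n1P := linkP _ _ _ _ _ _ _ _ _ _ _ _ r1P r2P y1P y2P m1 wP.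
have n2P := linkP _ _ _ _ _ _ _ _ _ _ _ _ r2P r3P y2P y3P m2 wP.
have n3P := linkP _ _ _ _ _ _ _ _ _ _ _ _ r3P r4P y3P y4P m3 wP.
set N1 := inner_link ival_arith R1 _ _ _ _ _ in n1P *.
set N2 := inner_link ival_arith R2 _ _ _ _ _ in n2P *.
set N3 := inner_link ival_arith R3 _ _ _ _ _ in n3P *.
set n1 := inner_link (real_arith R) r1 _ _ _ _ _ in n1P *.
set n2 := inner_link (real_arith R) r2 _ _ _ _ _ in n2P *.
set n3 := inner_link (real_arith R) r3 _ _ _ _ _ in n3P *.
have dP (r r' n : R) A A' B : ival_in r A -> ival_in r' A' -> ival_in n B ->
    ival_in (asub (real_arith R) (amul (real_arith R) r r') (asqr (real_arith R) n))
      (asub ival_arith (amul ival_arith A A') (asqr ival_arith B)).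
  by move=> *; apply: ival_subP; [apply: ival_mulP | apply: ival_sqrP].
have d1P := dP _ _ _ _ _ _ r1P r2P n1P.
have d2P := dP _ _ _ _ _ _ r2P r3P n2P.
have d3P := dP _ _ _ _ _ _ r3P r4P n3P.
set D1 := asub ival_arith (amul _ R1 R2) _ in d1P *.
set D2 := asub ival_arith (amul _ R2 R3) _ in d2P *.
set D3 := asub ival_arith (amul _ R3 R4) _ in d3P *.
set d1 := asub (real_arith R) (amul _ r1 r2) _ in d1P *.
set d2 := asub (real_arith R) (amul _ r2 r3) _ in d2P *.
set d3 := asub (real_arith R) (amul _ r3 r4) _ in d3P *.
have q1P := signedP s1 _ _ (ival_sqrtP d1P).
have q2P := signedP s2 _ _ (ival_sqrtP d2P).
have q3P := signedP s3 _ _ (ival_sqrtP d3P).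
have denP := ival_mulP r2P r3P.
move=> R10 R20 R30 R40 D10 D20 D30 den0; split.
  move=> x; rewrite !inE => /or4P[/eqP->|/eqP->|/eqP->|].
  - exact: ival_posP T40 t4P.
  - exact: ival_posP R10 r1P.
  - exact: ival_posP R20 r2P.
  move=> /or4P[/eqP->|/eqP->|/eqP->|].
  - exact: ival_posP R30 r3P.
  - exact: ival_posP R40 r4P.
  - exact: ival_posP D10 d1P.
  move=> /or3P[/eqP->|/eqP->|/eqP->].
  - exact: ival_posP D20 d2P.
  - exact: ival_posP D30 d3P.
  - exact: ival_posP den0 denP.
apply: ival_subP.
  do ?apply: ival_addP => //.
  by apply: ival_mulP => //; apply/ival_sqrP/ival_subP.
have eP := ival_subP
  (ival_mulP (ival_subP (ival_mulP n1P n2P) (ival_mulP q1P q2P)) n3P)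
  (ival_mulP (ival_addP (ival_mulP q1P n2P) (ival_mulP q2P n1P)) q3P).
apply: ival_mulP; first exact: ival_addP.
by apply: ival_invP => //; apply/Z.ltb_lt.
Qed.
End ClosureSoundness.

(** * The fifth root of 132 *)

Section FifthRoot.
Context (R : rcfType).
Implicit Types x y : R.

Lemma fifth_root_lt x y : 0 <= x -> 0 <= y -> x ^+ 5 < y ^+ 5 -> x < y.
Proof. by move=> x0 y0; rewrite ltr_pXn2r. Qed.

Lemma fifth_root_132_bounds x : 0 <= x -> x ^+ 5 = 132 -> 2 < x < 3.
Proof.
by move=> x0 x5; apply/andP; split; apply: fifth_root_lt; rewrite ?x5//; lra.
Qed.

(** The base 10 and the block of digits 655 are variables here, so that [field] and [lra] meet small
    numerals only. *)
Lemma decimal_approx (x d k : R) : 0 < d ->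
    2 * d ^+ 5 + k * d ^+ 2 + 3 * d - 5 < x * d ^+ 5 <
      2 * d ^+ 5 + k * d ^+ 2 + 3 * d + 5 ->
  `|x - (2 + k / d ^+ 3 + 3 / d ^+ 4)| < 5 / d ^+ 5.
Proof.
move=> d0 bounds; have d5 : 0 < d ^+ 5 by rewrite exprn_gt0.
have -> : x - (2 + k / d ^+ 3 + 3 / d ^+ 4) =
    (x * d ^+ 5 - (2 * d ^+ 5 + k * d ^+ 2 + 3 * d)) / d ^+ 5.
  by field; rewrite gt_eqF.
rewrite normrM normfV (gtr0_norm d5) ltr_pM2r ?invr_gt0// ltr_norml.
by apply/andP; split; lra.
Qed.

(* Scaled by [10 ^ 5], the two inequalities reduce to comparing
   [265525 ^ 5 < 132 * 10 ^ 25 < 265535 ^ 5] in [Z]. *)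
Lemma fifth_root_132 x : 0 <= x -> x ^+ 5 = 132 ->
  `|x - (2 + 655 / 10 ^+ 3 + 3 / 10 ^+ 4)| < 5 / 10 ^+ 5.
Proof.
move=> x0 x5; apply: decimal_approx; first by rewrite ltr0n.
have zX5 a : zr R (a * a * a * a * a) = zr R a ^+ 5 by rewrite !zrM; ring.
have d5 : 10 ^+ 5 = zr R 100000.
  by rewrite -[RHS]/(zr R (10 * 10 * 10 * 10 * 10)) zX5 -(zr_nat R 10).
have zd m : zr R (265530 + m) = 2 * 10 ^+ 5 + 655 * 10 ^+ 2 + 3 * 10 + zr R m.
  rewrite -[LHS]/(zr R (2 * 100000 + 655 * (10 * 10) + 3 * 10 + m)).
  by rewrite !zrD !zrM d5 -(zr_nat R 10) -(zr_nat R 655) -(zr_nat R 2) -(zr_nat R 3).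
have lo := zd (-5); have hi := zd 5.
rewrite zrN (zr_nat R 5) in lo; rewrite (zr_nat R 5) in hi.
rewrite -lo -hi d5.
have xd0 : 0 <= x * zr R 100000 by apply: (mulr_ge0 x0); apply: zr_ge0.
have xd5 : (x * zr R 100000) ^+ 5 = zr R (132 * (100000 * 100000 * 100000 * 100000 * 100000)).
  by rewrite exprMn x5 [RHS]zrM [X in _ = _ * X]zX5; congr (_ * _).
have lt_x a b : Z.le 0 a -> Z.le 0 b ->
    Z.lt (a * a * a * a * a) (132 * (100000 * 100000 * 100000 * 100000 * 100000)) ->
    Z.lt (132 * (100000 * 100000 * 100000 * 100000 * 100000)) (b * b * b * b * b) ->
    zr R a < x * zr R 100000 < zr R b.
  move=> /(zr_ge0 R) a0 /(zr_ge0 R) b0 /(zr_lt R) + /(zr_lt R).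
  rewrite -xd5 !zX5 => xa xb; apply/andP; split.
    exact: fifth_root_lt a0 xd0 xa.
  exact: fifth_root_lt xd0 b0 xb.
exact: lt_x.
Qed.

(** With [n = 3 + k + 5 j] and [k <= 4] the bound is [2 ^ k * x ^ (5 j)]. The lower constant comes
    from [3 + k <= 7], the upper estimate from [2 < x]. *)
Lemma bound_sandwich x (n : nat) : 0 <= x -> x ^+ 5 = 132 -> (3 <= n)%N ->
  x ^- 7 * x ^+ n <= (2 ^ ((n - 3) %% 5) * 132 ^ ((n - 3) %/ 5))%:R
    <= x ^+ n.
Proof.
move=> x0 x5 n3; have /andP[x2 x3] := fifth_root_132_bounds x0 x5.
have x1 : 1 <= x by lra.
rewrite natrM !natrX -x5 -exprM.
set k := (_ %% _)%N; set j := (_ %/ _)%N.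
have k4 : (k < 5)%N by rewrite ltn_mod.
have -> : n = (3 + k + 5 * j)%N.
  by rewrite [(5 * j)%N]mulnC -addnA [(k + _)%N]addnC -divn_eq subnKC.
have xp m : 0 <= x ^+ m by rewrite exprn_ge0.
rewrite exprD mulrA; apply/andP; split; rewrite ler_wpM2r//.
  rewrite ler_pdivrMl ?exprn_gt0//; last by lra.
  apply: (@le_trans _ _ (x ^+ 7)); first by rewrite ler_weXn2l//; lia.
  by rewrite ler_peMr// exprn_ege1// ler1n.
apply: (@le_trans _ _ (x ^+ k)); first by rewrite lerXn2r// ?nnegrE//; lra.
by rewrite ler_weXn2l// leq_addl.
Qed.
End FifthRoot.

(** * The 66 solutions *)

(* An interval of values of the squared distance between the vertices 1 and 4, in
   units of [2 ^ -32], with the indices of the orientations of both chains. *)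
Record bracket := Bracket {
  bracket_s : nat; bracket_s' : nat; bracket_lo : Z; bracket_hi : Z
}.

(** Reversing all three orientations does not change the closing distance, where the signed roots
    occur only in products of two. The eight sign patterns thus form four classes, each represented
    once. *)
Definition orientation (j : nat) : bool * bool * bool :=
  match j with
  | 0 => (false, false, false)
  | 1 => (true, false, false)
  | 2 => (false, false, true)
  | _ => (false, true, false)
  end.

Section Certificate.
Local Open Scope Z_scope.

(* Squared lengths, in units of [2 ^ -8]; found by numerical search. *)
Definition length_data : seq Z :=
  [:: 392; 430; 57; 28273; 31532; 3719; 3862; 46; 3832; 22; 28236; 257; 28413;
      1185; 28882; 367; 1330; 4456].

Definition brackets : seq bracket :=
  [:: Bracket 0 0 51312984064 51314032640; Bracket 0 0 53284438016 53418655744;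
      Bracket 0 0 73484206080 74021076992; Bracket 0 0 77837893632 77905002496;
      Bracket 0 0 78955675648 78964064256; Bracket 0 1 54795436032 54803824640;
      Bracket 0 1 72746008576 73282879488; Bracket 0 1 77376520192 77644955648;
      Bracket 0 2 51578404864 51586793472; Bracket 0 2 51799654400 51866763264;
      Bracket 0 2 71873593344 72410464256; Bracket 0 2 78206992384 78240546816;
      Bracket 0 2 78408515584 78408646656; Bracket 0 2 78906621952 78906687488;
      Bracket 0 2 78928412672 78936801280; Bracket 0 3 51474595840 51478790144;
      Bracket 0 3 52344913920 52613349376; Bracket 0 3 68472012800 68488790016;
      Bracket 1 0 51275366400 51308920832; Bracket 1 0 55566139392 55834574848;
      Bracket 1 0 78542536704 78609645568; Bracket 1 0 78959869952 78968258560;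
      Bracket 1 1 51256680448 51256745984; Bracket 1 1 61907927040 62176362496;
      Bracket 1 1 78819360768 78886469632; Bracket 1 1 78903246848 78936801280;
      Bracket 1 2 51556384768 51690602496; Bracket 1 2 51875151872 52143587328;
      Bracket 1 2 77795950592 77863059456; Bracket 1 3 51388612608 51522830336;
      Bracket 1 3 54123298816 54257516544; Bracket 1 3 60062433280 60330868736;
      Bracket 1 3 62914560000 63182995456; Bracket 1 3 72944943104 72945205248;
      Bracket 2 0 51417972736 51451527168; Bracket 2 0 54928605184 55197040640;
      Bracket 2 0 71605157888 72142028800; Bracket 2 0 77712064512 77846282240;
      Bracket 2 1 51358482432 51358613504; Bracket 2 1 57380175872 57396953088;
      Bracket 2 1 69659000832 70195871744; Bracket 2 1 77275856896 77544292352;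
      Bracket 2 2 51908706304 51925483520; Bracket 2 2 52412022784 52680458240;
      Bracket 2 2 70531416064 71068286976; Bracket 2 2 78307655680 78374764544;
      Bracket 2 2 78579892224 78580416512; Bracket 2 2 78947876864 78948007936;
      Bracket 2 2 78963539968 78967734272; Bracket 2 3 51606716416 51740934144;
      Bracket 2 3 54274293760 54341402624; Bracket 2 3 66093842432 66160951296;
      Bracket 3 0 51314425856 51315474432; Bracket 3 0 54727278592 54995714048;
      Bracket 3 0 78857109504 78890663936; Bracket 3 1 51285078016 51285110784;
      Bracket 3 1 61673046016 61941481472; Bracket 3 1 78947287040 78964064256;
      Bracket 3 1 78966685696 78968782848; Bracket 3 2 51589939200 51598327808;
      Bracket 3 2 51897171968 51905560576; Bracket 3 2 78467039232 78500593664;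
      Bracket 3 3 51479314432 51483508736; Bracket 3 3 53519319040 53787754496;
      Bracket 3 3 59525562368 59793997824; Bracket 3 3 69598183424 69606572032].

(** The shift by 24 converts units of [2 ^ -8] into units of [2 ^ -32]; one unit of margin on each
    side makes room for the open box of lengths. *)
Definition length_ival (e : nat) : ival :=
  let x := Z.shiftl (nth 0 length_data e) 24 in (x - 1, x + 1).

Definition closures (T : Type) (A : arith T) (l : nat -> T) (r : bracket) (t : T) :=
  let: (s1, s2, s3) := orientation (bracket_s r) in
  let: (s1', s2', s3') := orientation (bracket_s' r) in
  let B := chain_closure A (chain03 l) s1 s2 s3 t in
  let C := chain_closure A (chain14 l) s1' s2' s3' B.2 in
  (B, C).

Definition bracket_pos (x : (seq ival * ival) * (seq ival * ival)) : bool :=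
  all ival_pos x.1.1 && all ival_pos x.2.1.

Definition bracket_box (r : bracket) : ival * ival :=
  let T := (bracket_lo r, bracket_hi r) in
  (T, (closures ival_arith length_ival r T).1.2).

(* The last condition makes the composition of both closures minus the identity
   change sign. *)
Definition bracket_ok (r : bracket) : bool :=
  let lo := bracket_lo r in let hi := bracket_hi r in
  let c := closures ival_arith length_ival r (lo, hi) in
  let a := closures ival_arith length_ival r (lo, lo) in
  let b := closures ival_arith length_ival r (hi, hi) in
  [&& lo <=? hi, bracket_pos c, bracket_pos a, bracket_pos b &
      (hi <=? b.2.2.1) && (a.2.2.2 <=? lo) ||
      (lo <=? a.2.2.1) && (b.2.2.2 <=? hi)].

Definition ival_disjoint (a b : ival) : bool := (a.2 <? b.1) || (b.2 <? a.1).
Definition box_disjoint (x y : ival * ival) : bool :=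
  ival_disjoint x.1 y.1 || ival_disjoint x.2 y.2.

Lemma brackets_ok : all bracket_ok brackets.
Proof. by vm_compute. Qed.

(** Some brackets with different orientations overlap in t; the enclosures of u computed from them
    then separate the solutions. *)
Lemma brackets_disjoint : pairwise box_disjoint (map bracket_box brackets).
Proof. by vm_compute. Qed.

Lemma size_brackets : size brackets = 66%nat.
Proof. by []. Qed.
End Certificate.

(** * Existence of the solutions *)

Section Continuity.
Context (R : realType).

(** The filter is a parameter so that the same rules serve full neighbourhoods, for the closures,
    and neighbourhoods within [0, 1], along a deformation. *)
Definition tends (F : set_system R) (t : R) (f : R -> R) : Prop :=
  f x @[x --> F] --> f t.

Section Filters.
Context (F : set_system R) {FF : Filter F} (t : R).
Implicit Types f g : R -> R.
Local Notation ctn f := (tends F t f).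

Lemma tends_cst (k : R) : ctn (fun=> k).
Proof. exact: cvg_cst. Qed.
Lemma tendsD f g : ctn f -> ctn g -> ctn (fun x => f x + g x).
Proof. exact: cvgD. Qed.
Lemma tendsN f : ctn f -> ctn (fun x => - f x).
Proof. exact: cvgN. Qed.
Lemma tendsM f g : ctn f -> ctn g -> ctn (fun x => f x * g x).
Proof. exact: cvgM. Qed.
Lemma tendsX f : ctn f -> ctn (fun x => f x ^+ 2).
Proof. by move=> cf; apply: (tendsM cf cf). Qed.
Lemma tendsV f : f t != 0 -> ctn f -> ctn (fun x => (f x)^-1).
Proof. exact: cvgV. Qed.
Lemma tends_comp f g : ctn f -> tends (nbhs (f t)) (f t) g -> ctn (fun x => g (f x)).
Proof. exact: (@cvg_comp _ _ _ f g). Qed.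
Lemma tends_sqrt f : ctn f -> ctn (fun x => Num.sqrt (f x)).
Proof. by move=> cf; apply: (tends_comp cf); exact: sqrt_continuous. Qed.
End Filters.

Lemma tends_id t : tends (nbhs t) t id.
Proof. exact: cvg_id. Qed.

Local Notation ctn t f := (tends (nbhs t) t f).

Lemma chain_closure_continuous (c : chain R) s1 s2 s3 t :
    (forall x, x \in (chain_closure (real_arith R) c s1 s2 s3 t).1 -> 0 < x) ->
  ctn t (fun t => (chain_closure (real_arith R) c s1 s2 s3 t).2).
Proof.
rewrite /chain_closure; cbn [fst snd] => pos.
have t0 : t + t + (t + t) != 0.
  by rewrite gt_eqF//; apply: pos; rewrite inE eqxx.
have sC s f : ctn t f -> ctn t (fun x => signed (real_arith R) s (f x)).
  by case: s => //; apply: tendsN.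
pose w x : R := (x + x + (x + x))^-1.
have wC : ctn t w.
  by apply: tendsV => //; do ?apply: tendsD; exact: tends_id.
pose y p q (x : R) : R := p - q + x.
have yC p q : ctn t (y p q).
  by apply: tendsD; [exact: tends_cst | exact: tends_id].
pose r p q x : R := p - y p q x ^+ 2 * w x.
have rC p q : ctn t (r p q).
  by apply: tendsD; [exact: tends_cst | apply: tendsN; apply: tendsM => //; exact: tendsX].
pose n (r r' y y' : R -> R) m x : R :=
  (r x + r' x + (y x - y' x) ^+ 2 * w x - m) / 2.
have yyC y1 y2 : ctn t y1 -> ctn t y2 -> ctn t (fun x => (y1 x - y2 x) ^+ 2 * w x).
  by move=> *; apply: tendsM => //; apply: tendsX; apply: tendsD => //; apply: tendsN.
have nC r1 r2 y1 y2 m : ctn t r1 -> ctn t r2 -> ctn t y1 -> ctn t y2 ->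
    ctn t (n r1 r2 y1 y2 m).
  move=> *; apply: tendsM; last exact: tends_cst.
  apply: tendsD; last exact: tends_cst.
  by apply: tendsD; [exact: tendsD | exact: yyC].
pose q (r r' n : R -> R) s x : R :=
  signed (real_arith R) s (Num.sqrt (r x * r' x - n x ^+ 2)).
have qC r1 r2 n1 s : ctn t r1 -> ctn t r2 -> ctn t n1 -> ctn t (q r1 r2 n1 s).
  move=> *; apply: sC; apply: tends_sqrt; apply: tendsD.
    exact: tendsM.
  by apply: tendsN; apply: tendsX.
pose y1 := y (cp1 c) (cq1 c); pose y2 := y (cp2 c) (cq2 c).
pose y3 := y (cp3 c) (cq3 c); pose y4 := y (cp4 c) (cq4 c).
pose r1 := r (cp1 c) (cq1 c); pose r2 := r (cp2 c) (cq2 c).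
pose r3 := r (cp3 c) (cq3 c); pose r4 := r (cp4 c) (cq4 c).
have y1C : ctn t y1 := yC _ _.
have y2C : ctn t y2 := yC _ _.
have y3C : ctn t y3 := yC _ _.
have y4C : ctn t y4 := yC _ _.
have r1C : ctn t r1 := rC _ _.
have r2C : ctn t r2 := rC _ _.
have r3C : ctn t r3 := rC _ _.
have r4C : ctn t r4 := rC _ _.
pose n1 := n r1 r2 y1 y2 (cm1 c); pose n2 := n r2 r3 y2 y3 (cm2 c).
pose n3 := n r3 r4 y3 y4 (cm3 c).
have n1C : ctn t n1 by exact: nC.
have n2C : ctn t n2 by exact: nC.
have n3C : ctn t n3 by exact: nC.
pose q1 := q r1 r2 n1 s1; pose q2 := q r2 r3 n2 s2; pose q3 := q r3 r4 n3 s3.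
have q1C : ctn t q1 by exact: qC.
have q2C : ctn t q2 by exact: qC.
have q3C : ctn t q3 by exact: qC.
pose e x : R := (n1 x * n2 x - q1 x * q2 x) * n3 x - (q1 x * n2 x + q2 x * n1 x) * q3 x.
have eC : ctn t e.
  apply: tendsD; last apply: tendsN; (apply: tendsM => //; apply: tendsD; first exact: tendsM).
  by apply: tendsN; exact: tendsM.
  exact: tendsM.
have den0 : r2 t * r3 t != 0.
  by rewrite gt_eqF//; apply: pos; rewrite !inE eqxx ?orbT.
pose F x : R := r1 x + r4 x + (y1 x - y4 x) ^+ 2 * w x - (e x + e x) * (r2 x * r3 x)^-1.
suff FC : ctn t F by exact: FC.
apply: tendsD; first by apply: tendsD; [exact: tendsD | exact: yyC].
by apply: tendsN; apply: tendsM; [exact: tendsD | apply: tendsV => //; exact: tendsM].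
Qed.
End Continuity.

(** * A vertex joined to the three corners of the triangle *)

Section Apex.
Context (R : realFieldType).

(** Seen from the first corner, [u] and [v] are the inner products of the apex with the two sides
    and [h] is its squared distance. Cramer's rule gives the foot of the perpendicular, and [c] is
    the height in units of the length of the cross product. *)
Lemma apex_quad (l1 l2 g u v h a b c : R) (D := gram2 l1 l2 g) : D != 0 ->
    c ^+ 2 = (h - (l2 * u ^+ 2 - 2 * g * u * v + l1 * v ^+ 2) / D) / D ->
  quad l1 l2 g
    (sub3 (a, b, 0) ((l2 * u - g * v) / D, (l1 * v - g * u) / D, c)) =
  h + a ^+ 2 * l1 + 2 * a * b * g + b ^+ 2 * l2 - 2 * (a * u + b * v).
Proof.
rewrite /quad /sub3 /= sub0r sqrrN -/D => D0 ->; rewrite /D /gram2 in D0 *.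
by field.
Qed.

(** The quotient is the squared distance from the first corner to the foot of the perpendicular. Its
    numerator is at most 200 and its denominator at least 1/5, so squared apex edges between 1000
    and 1001 always leave a positive height. *)
Lemma apex_bound (l1 l2 g u v : R) : 1 <= l1 <= 2 -> 1 <= l2 <= 2 -> 1 <= g <= 2 ->
    -2 <= u <= 2 -> -2 <= v <= 2 -> 5^-1 <= gram2 l1 l2 g ->
  (l2 * u ^+ 2 - 2 * g * u * v + l1 * v ^+ 2) / gram2 l1 l2 g <= 1000.
Proof.
set D := gram2 _ _ _ => b1 b2 b3 ub vb D5; clearbody D.
rewrite ler_pdivrMr; last by lra.
have u4 : u ^+ 2 <= 4 by clear -ub; nra.
have v4 : v ^+ 2 <= 4 by clear -vb; nra.
have uv0 : 0 <= (u + v) ^+ 2 by rewrite sqr_ge0.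
apply: (@le_trans _ _ 200); last by lra.
have := sqr_ge0 u; have := sqr_ge0 v => *.
have h1 : l2 * u ^+ 2 <= 8 by nra.
have h2 : l1 * v ^+ 2 <= 8 by nra.
have h3 : - (u * v) <= 4 by nra.
by nra.
Qed.

Lemma polar_bound (p l q : R) : 1000 < p < 1001 -> 1000 < q < 1001 ->
  1 <= l <= 2 -> -2 <= polar p l q <= 2.
Proof. by rewrite /polar => *; apply/andP; split; lra. Qed.
End Apex.

(** * Blocks attached to a triangle *)

Section VertexCoords.
Context (R : realFieldType).

Definition vertex_coords (W : Type) (w : W -> point R) (v : 'I_3 + W) : point R :=
  match v with
  | inl k => ((k == 1%N :> nat)%:R, (k == 2%N :> nat)%:R, 0)
  | inr x => w x
  end.

End VertexCoords.

Section Blocks.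
Context (R : rcfType) (T : R -> R -> R -> Prop).

(** Every edge is listed with a new vertex as second end, so a reversed duplicate can occur only
    between two new vertices. *)
Definition simple (W F : Type) (ends : F -> ('I_3 + W) * W) : Prop :=
  (forall f, (ends f).1 <> inr (ends f).2) /\
  forall f g, ends f = ends g \/
    (ends f).1 = inr (ends g).2 /\ (ends g).1 = inr (ends f).2 -> f = g.

Definition realizes (W F : Type) (ends : F -> ('I_3 + W) * W)
    (l1 l2 l12 : R) (l : F -> R) (w : W -> point R) : Prop :=
  forall f, quad l1 l2 (polar l1 l2 l12)
    (sub3 (vertex_coords w (ends f).1) (w (ends f).2)) = l f.

(* A graph on a triangle and [m] further vertices, with [3 m] further edges, that
   has [N] realizations for all squared lengths in an open box, given by the
   coordinates of the further vertices in the frame of the triangle. *)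
Definition block (m N : nat) : Prop :=
  exists (W F S : finType) (ends : F -> ('I_3 + W) * W) (lo hi : F -> R),
    [/\ #|W| = m, #|F| = (3 * m)%N, #|S| = N, simple ends &
      (forall f, 0 <= lo f < hi f) /\
      forall l1 l2 l12, T l1 l2 l12 -> forall l, (forall f, lo f < l f < hi f) ->
      exists2 q : S -> W -> point R, forall s, realizes ends l1 l2 l12 l (q s) &
        forall s s', q s =1 q s' -> s = s'].

Lemma block0 : block 0 1.
Proof.
exists void, void, unit, (fun f : void => match f with end), (fun=> 0), (fun=> 0).
split; rewrite ?card_void ?card_unit//; split => [[]|] //.
move=> l1 l2 l12 _ l _; exists (fun _ (f : void) => match f with end).
  by move=> s [].
by move=> [] [].
Qed.

Definition glue_inl (W W' : Type) (v : 'I_3 + W) : 'I_3 + (W + W') :=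
  match v with inl k => inl k | inr x => inr (inl x) end.
Definition glue_inr (W W' : Type) (v : 'I_3 + W') : 'I_3 + (W + W') :=
  match v with inl k => inl k | inr x => inr (inr x) end.

(** In the frame of the shared triangle the equations of the two blocks have no unknown in common,
    so realizations of the union are pairs of realizations. *)
Lemma block_glue m N m' N' : block m N -> block m' N' -> block (m + m') (N * N').
Proof.
move=> [W [F [S [ends [lo [hi [Wm Fm SN [loop mult] [box sol]]]]]]]].
move=> [W' [F' [S' [ends' [lo' [hi' [Wm' Fm' SN' [loop' mult'] [box' sol']]]]]]]].
pose e (f : F + F') : ('I_3 + (W + W')) * (W + W') := match f with
  | inl f => (glue_inl W' (ends f).1, inl (ends f).2)
  | inr f => (glue_inr W (ends' f).1, inr (ends' f).2) end.
pose join (A : Type) (g : F -> A) (g' : F' -> A) f :=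
  match f with inl f => g f | inr f => g' f end.
exists (W + W')%type, (F + F')%type, (S * S')%type, e, (join _ lo lo'), (join _ hi hi').
split.
- by rewrite card_sum Wm Wm'.
- by rewrite card_sum Fm Fm' mulnDr.
- by rewrite card_prod SN SN'.
- split; first by case=> f /=; [have := loop f | have := loop' f];
    case: (_ f) => [[k|x] y] //= h [xy]; apply: h; rewrite xy.
  case=> f [] g /=.
  + move=> h; congr inl; apply: mult; move: h.
    by case: (ends f) (ends g) => [[k|x] y] [[k'|x'] y'] /= [[] | [] [] // -> [->]];
      [left; congruence..| right].
  + by case: (ends f) (ends' g) => [[k|x] y] [[k'|x'] y'] /= [[] | []].
  + by case: (ends g) (ends' f) => [[k|x] y] [[k'|x'] y'] /= [[] | []].
  + move=> h; congr inr; apply: mult'; move: h.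
    by case: (ends' f) (ends' g) => [[k|x] y] [[k'|x'] y'] /= [[] | [] [] // -> [->]];
      [left; congruence..| right].
split; first by case=> f /=.
move=> l1 l2 l12 Tl l lbox.
have [q qr qi] := sol _ _ _ Tl (l \o inl) (fun f => lbox (inl f)).
have [q' qr' qi'] := sol' _ _ _ Tl (l \o inr) (fun f => lbox (inr f)).
exists (fun s x => match x with inl x => q s.1 x | inr x => q' s.2 x end).
  move=> [s s'] [] f /=; rewrite -1?(qr s f : _ = l (inl f)) -1?(qr' s' f : _ = l (inr f)).
    by case: (ends f) => [[k|x] y].
  by case: (ends' f) => [[k|x] y].
move=> [s s'] [r r'] qq; congr (_, _).
  by apply: qi => x; apply: (qq (inl x)).
by apply: qi' => x; apply: (qq (inr x)).
Qed.

Hypothesis T_bounds : forall l1 l2 l12, T l1 l2 l12 ->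
  [/\ 1 <= l1 <= 2, 1 <= l2 <= 2, 1 <= polar l1 l2 l12 <= 2 &
      5^-1 <= gram2 l1 l2 (polar l1 l2 l12)].

Lemma block_apex : block 1 2.
Proof.
exists unit, 'I_3, bool, (fun k => (inl k, tt)), (fun=> 1000), (fun=> 1001).
split; rewrite ?card_unit ?card_ord ?card_bool//.
  by split=> // k k' [[]//|[]].
split=> [_|l1 l2 l12 Tl h hbox]; first by apply/andP; split; lra.
have [b1 b2] := T_bounds Tl; set g := polar _ _ _; rewrite /gram2.
set D := _ - _ => b3 D5.
pose u := polar (h 0) l1 (h 1); pose v := polar (h 0) l2 (h 2%:R).
pose m := (l2 * u ^+ 2 - 2 * g * u * v + l1 * v ^+ 2) / D.
have D0 : 0 < D by lra.
have h0 := hbox 0; have h1 := hbox 1; have h2 := hbox 2%:R.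
have mb : m <= 1000 by apply: apex_bound => //; apply: polar_bound.
have gam : 0 < (h 0 - m) / D.
  by apply: divr_gt0 => //; rewrite subr_gt0 (le_lt_trans mb)//; case/andP: h0.
exists (fun (s : bool) _ => ((l2 * u - g * v) / D, (l1 * v - g * u) / D,
   (-1) ^+ s * Num.sqrt ((h 0 - m) / D))).
  move=> s k.
  have sE : ((-1) ^+ s * Num.sqrt ((h 0 - m) / D)) ^+ 2 = (h 0 - m) / D.
    by rewrite exprMn sqr_sqrtr ?ltW// -exprM mulnC exprM sqrrN expr1n expr1n mul1r.
  have D1 : gram2 l1 l2 g != 0 by rewrite gt_eqF.
  rewrite (apex_quad _ _ D1 sE).
  have : k = 0 \/ k = 1 \/ k = 2%:R.
    by case: k => [[|[|[|?]]] ?] //; [left | right; left | right; right]; apply: val_inj.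
  by rewrite /u /v /polar => -[-> | [-> | ->]] /=; field.
move=> s s' /(_ tt) [] /mulIf; rewrite gt_eqF ?sqrtr_gt0// => /(_ isT).
exact: signr_inj.
Qed.
End Blocks.

(** * The snub disphenoid as a block *)

Section DisphenoidBlock.
Context (R : rcfType).

Definition near_data (l : nat -> R) : Prop :=
  forall e, (e < 18)%N -> ival_in (l e) (length_ival e).

Definition near_triangle (l1 l2 l12 : R) : Prop :=
  [/\ ival_in l1 (length_ival 0), ival_in l2 (length_ival 1) &
      ival_in l12 (length_ival 2)].

Definition vertex_nat (v : 'I_3 + 'I_5) : nat :=
  match v with inl k => k | inr x => 3 + x end.
Definition nat_vertex (a : nat) : 'I_3 + 'I_5 :=
  if (a < 3)%N then inl (inord a) else inr (inord (a - 3)).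

Lemma nat_vertexK a : (a < 8)%N -> vertex_nat (nat_vertex a) = a.
Proof.
move=> a8; rewrite /nat_vertex; case: ltnP => a3 /=; first by rewrite inordK.
by rewrite inordK; lia.
Qed.

Definition new_edge (f : nat) : nat * nat := nth (0, 0)%N disphenoid_edges (3 + f).

Definition disphenoid_ends (f : 'I_15) : ('I_3 + 'I_5) * 'I_5 :=
  (nat_vertex (new_edge f).1, inord ((new_edge f).2 - 3)).

Lemma new_edge_bound f : (f < 15)%N ->
  ((new_edge f).1 < 8)%N && (3 <= (new_edge f).2 < 8)%N.
Proof.
move=> f15; have/allP-> // : all (fun f => ((new_edge f).1 < 8)%N &&
  (3 <= (new_edge f).2 < 8)%N) (iota 0 15) by [].
by rewrite mem_iota.
Qed.

Lemma disphenoid_endsE (f : 'I_15) :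
  new_edge f = (vertex_nat (disphenoid_ends f).1, vertex_nat (inr (disphenoid_ends f).2)).
Proof.
have /and3P[a8 b3 b8] := new_edge_bound (ltn_ord f).
by rewrite nat_vertexK// /= inordK ?subnKC//; [case: new_edge | lia].
Qed.

Lemma disphenoid_simple : simple disphenoid_ends.
Proof.
have ok : all (fun f => ((new_edge f).1 != (new_edge f).2) &&
    all (fun g => (new_edge f \in [:: new_edge g; ((new_edge g).2, (new_edge g).1)])
         ==> (f == g)) (iota 0 15)) (iota 0 15) by [].
have okf (f : 'I_15) := allP ok f; split=> [f|f g fg].
  have /andP[] := okf f (ltac:(by rewrite mem_iota ltn_ord)).
  by rewrite disphenoid_endsE => /eqP h _ h'; apply: h; have := congr1 vertex_nat h'.
have /andP[_ /allP /(_ g)] := okf f (ltac:(by rewrite mem_iota ltn_ord)).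
rewrite mem_iota ltn_ord => /(_ isT) /implyP h; apply/val_inj/eqP/h.
rewrite !inE !disphenoid_endsE; case: fg => [->|[-> ->]]; first by rewrite eqxx.
by apply/orP; right.
Qed.

Lemma ival_disjointP (x : R) a b : ival_disjoint a b -> ival_in x a -> ival_in x b -> False.
Proof.
move=> ab /andP[ax xa] /andP[bx xb]; case/orP: ab => /Z.ltb_lt/(zr_lt R) h.
  by have := le_lt_trans bx (le_lt_trans xa h); rewrite ltxx.
by have := le_lt_trans ax (le_lt_trans xb h); rewrite ltxx.
Qed.

Definition nth_box (i : nat) : ival * ival :=
  nth ((Z0, Z0), (Z0, Z0)) (map bracket_box brackets) i.

Lemma nth_box_inj i j (t u : R) : (i < 66)%N -> (j < 66)%N ->
    ival_in t (nth_box i).1 -> ival_in u (nth_box i).2 ->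
    ival_in t (nth_box j).1 -> ival_in u (nth_box j).2 -> i = j.
Proof.
have main i' j' : (i' < 66)%N -> (j' < 66)%N -> (i' < j')%N ->
    ival_in t (nth_box i').1 -> ival_in u (nth_box i').2 ->
    ival_in t (nth_box j').1 -> ival_in u (nth_box j').2 -> False.
  move=> i66 j66 ij ti ui tj uj.
  have := (pairwiseP ((Z0, Z0), (Z0, Z0)) brackets_disjoint) i' j'.
  rewrite !inE size_map size_brackets => /(_ i66 j66 ij) /orP[] h.
    exact: (ival_disjointP h ti tj).
  exact: (ival_disjointP h ui uj).
move=> i66 j66 ti ui tj uj; case: (ltngtP i j) => // ij.
  by case: (main _ _ i66 j66 ij).
by case: (main _ _ j66 i66 ij).
Qed.

Definition root_realization (l : nat -> R) (i : nat) (q : nat -> point R) : Prop :=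
  [/\ forall e, (e < 18)%N -> let uv := nth (0, 0)%N disphenoid_edges e in
          dist2 (q uv.1) (q uv.2) = l e,
      ival_in (dist2 (q 1) (q 4)) (nth_box i).1,
      ival_in (dist2 (q 0) (q 3)) (nth_box i).2 &
      det3 (sub3 (q 1) (q 0)) (sub3 (q 2) (q 0)) (sub3 (q 4) (q 0)) != 0].

Lemma length_ival_ge0 e : (e < 18)%N -> Z.le 0 (length_ival e).1.
Proof.
move=> e18; apply/Z.leb_le.
have/allP-> // : all (fun e => Z.leb 0 (length_ival e).1) (iota 0 18) by vm_compute.
by rewrite mem_iota.
Qed.

Lemma length_ival_lt e : Z.lt (length_ival e).1 (length_ival e).2.
Proof. by rewrite /length_ival /=; lia. Qed.

Lemma flip_triangle s (W : Type) (w : W -> point R) v :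
  vertex_coords (fun x => flip s (w x)) v = flip s (vertex_coords w v).
Proof. by case: v => //= k; rewrite /flip /= mulr0. Qed.

(** Frame coordinates determine all distances, among them t and u, whose disjoint boxes give back
    the index of the solution; only the choice between mirror images is then left. *)
Lemma block_disphenoid :
    (forall l, near_data l -> forall i, (i < 66)%N ->
      exists q, root_realization l i q) ->
  block near_triangle 5 132.
Proof.
move=> real.
pose lo (f : 'I_15) := zr R (length_ival (3 + f)).1 / scale R.
pose hi (f : 'I_15) := zr R (length_ival (3 + f)).2 / scale R.
have s0 := scale_gt0 R.
have edge_lt (f : 'I_15) : (3 + f < 18)%N by have := ltn_ord f; lia.
exists 'I_5, 'I_15, ('I_66 * bool)%type, disphenoid_ends, lo, hi.
split; rewrite ?card_prod ?card_ord ?card_bool//; first exact: disphenoid_simple.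
split=> [f|l1 l2 l12 [T1 T2 T12] l lbox].
  apply/andP; split; last first.
    by rewrite /lo /hi ltr_pM2r ?invr_gt0//; exact/zr_lt/length_ival_lt.
  apply: divr_ge0; last exact: ltW.
  exact: zr_ge0 (length_ival_ge0 (edge_lt f)).
pose L (e : nat) := if (e < 3)%N then nth 0 [:: l1; l2; l12] e else l (inord (e - 3)).
have Lnear : near_data L.
  move=> e e18; rewrite /L; case: ltnP => e3; first
    by case: e e3 {e18} => [_|[_|[_|//]]]; [exact: T1 | exact: T2 | exact: T12].
  have eE : (3 + (inord (e - 3) : 'I_15))%N = e by rewrite inordK; lia.
  have /andP[] := lbox (inord (e - 3)); rewrite /lo /hi eE.
  by rewrite ltr_pdivrMr// ltr_pdivlMr// /ival_in => /ltW-> /ltW->.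
have [q qP] : exists q : 'I_66 -> nat -> point R, forall i : 'I_66, root_realization L i (q i).
  by apply: (fin_all_exists (fun i : 'I_66 => real _ Lnear i (ltn_ord i))).
pose w i v := coords (q i 0%N) (q i 1%N) (q i 2%N) (q i v).
have DN i : tri_gram (q i 0%N) (q i 1%N) (q i 2%N) != 0.
  by have [_ _ _ /det3_tri_gram] := qP i.
have wE i u v : quad l1 l2 (polar l1 l2 l12) (sub3 (w i u) (w i v)) =
    dist2 (q i u) (q i v).
  have [len _ _ _] := qP i.
  have := len 0%N isT; have := len 1%N isT; have := len 2%N isT.
  rewrite /L /= => <- <- <-; exact/esym/coords_dist2.
have wv i v : vertex_coords (fun x : 'I_5 => w i (3 + x)%N) v = w i (vertex_nat v).
  case: v => //= k; have [h0 h1 h2] := coords_base (DN i).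
  by case: k => [[|[|[|?]]] ?] //=; rewrite /w ?h0 ?h1 ?h2.
have flipN (b : bool) : ((-1) ^+ b) ^+ 2 = 1 :> R by rewrite sqrr_sign.
pose Q (s : 'I_66 * bool) (x : 'I_5) := flip ((-1) ^+ s.2) (w s.1 (3 + x)%N).
have Qquad s u v : quad l1 l2 (polar l1 l2 l12)
    (sub3 (vertex_coords (Q s) u) (vertex_coords (Q s) v)) =
    dist2 (q s.1 (vertex_nat u)) (q s.1 (vertex_nat v)).
  by rewrite !flip_triangle quad_flip// !wv wE.
exists Q => [s f|[i b] [j c] Qij].
  rewrite -[Q s _]/(vertex_coords (Q s) (inr (disphenoid_ends f).2)) Qquad.
  have [len _ _ _] := qP s.1.
  have := len (3 + f)%N (edge_lt f).
  rewrite -/(new_edge f) disphenoid_endsE /L ltnNge leq_addr /= => ->.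
  by rewrite addnC addnK inord_val.
have Qv v : vertex_coords (Q (i, b)) v = vertex_coords (Q (j, c)) v.
  by case: v => //= x; exact: Qij.
have [_ ti ui deti] := qP i; have [_ tj uj _] := qP j.
have dE u v : (u < 8)%N -> (v < 8)%N ->
    dist2 (q i u) (q i v) = dist2 (q j u) (q j v).
  move=> u8 v8; have := Qquad (i, b) (nat_vertex u) (nat_vertex v).
  by rewrite !Qv Qquad !nat_vertexK.
rewrite -!dE// in tj uj.
have ij : i = j by apply/val_inj/(nth_box_inj _ _ ti ui tj uj).
rewrite -ij in Qij *; congr (_, _).
(* Vertex 4, of index 1 among the five further vertices, lies off the plane of the triangle, so its
   third coordinate tells mirror images apart. *)
have : (w i 4%N).2 != 0.
  by rewrite /w /coords /= mulf_neq0 ?invr_eq0//; apply: DN.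
move=> w4; have := congr1 snd (Qij 1) => /(mulIf w4); exact: signr_inj.
Qed.

Lemma near_triangle_bounds (l1 l2 l12 : R) : near_triangle l1 l2 l12 ->
  [/\ 1 <= l1 <= 2, 1 <= l2 <= 2, 1 <= polar l1 l2 l12 <= 2 &
      5^-1 <= gram2 l1 l2 (polar l1 l2 l12)].
Proof.
have s0 := scale_gt0 R.
(* The scale is written as 256 times an abstract [s'], which matches the unit [2 ^ -8] of the data
   and hides the large power of 2. *)
have [s' s'P] : exists s', zr R (2 ^ 24) = s' by exact: ex_intro.
have s'E : scale R = 256 * s' by rewrite -s'P scaleE -(zr_nat R 256) -zrM.
have s'0 : 256 <= s' by rewrite -s'P -(zr_nat R 256); apply: zr_le.
have approx (x : R) e K : nth Z0 length_data e = Z.of_nat K ->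
    ival_in x (length_ival e) -> K%:R - 256^-1 <= 256 * x <= K%:R + 256^-1.
  rewrite /ival_in /length_ival => ->; cbv zeta; cbn [fst snd].
  rewrite Z.shiftl_mul_pow2// zrB zrD zrM zr1 zr_nat s'P s'E.
  move: (K%:R : R) => k {s'P s'E} /andP[lo hi].
  have h : 1 <= 256^-1 * s' by lra.
  by apply/andP; split; rewrite -(ler_pM2r (_ : 0 < s')); lra.
clear s0 s' s'P s'E s'0.
move=> [/(approx _ 0%N 392%N erefl) b1 /(approx _ 1%N 430%N erefl) b2].
move=> /(approx _ 2%N 57%N erefl) b12; clear approx; rewrite /gram2 /polar.
have {}b1 : 153 / 100 <= l1 <= 154 / 100 by lra.
have {}b2 : 167 / 100 <= l2 <= 168 / 100 by lra.
have {}b12 : 22 / 100 <= l12 <= 23 / 100 by lra.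
have gb : 148 / 100 <= (l1 + l2 - l12) / 2 <= 150 / 100 by lra.
move: ((l1 + l2 - l12) / 2) gb => g gb.
split; [by lra.. | by clear -b1 b2 gb; nra].
Qed.
End DisphenoidBlock.

(** * Roots in the brackets and existence of all blocks *)

Section RootExistence.
Context (R : realType).
Implicit Types (l : nat -> R) (r : bracket) (t : R) (T : ival).

Lemma closures_in l r t T : near_data l -> ival_in t T ->
    bracket_pos (closures ival_arith length_ival r T) ->
  let c := closures (real_arith R) l r t in
  let C := closures ival_arith length_ival r T in
  [/\ forall x, x \in c.1.1 -> 0 < x, forall x, x \in c.2.1 -> 0 < x,
      ival_in c.1.2 C.1.2 & ival_in c.2.2 C.2.2].
Proof.
move=> lI tT; rewrite /closures /bracket_pos.
case: (orientation _) => [[s1 s2] s3]; case: (orientation _) => [[s1' s2'] s3'].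
case/andP=> posB posA.
have c03 : chain_in (chain03 l) (chain03 length_ival).
  by split; do ?split; exact: lI.
have c14 : chain_in (chain14 l) (chain14 length_ival).
  by split; do ?split; exact: lI.
have [Bpos BI] := chain_closureP c03 tT posB.
by have [Apos AI] := chain_closureP c14 BI posA; split.
Qed.

Local Notation ctn t f := (tends (nbhs t) t f).

Lemma closures_continuous l r t :
  let c := closures (real_arith R) l r t in
  (forall x, x \in c.1.1 -> 0 < x) -> (forall x, x \in c.2.1 -> 0 < x) ->
  ctn t (fun t => (closures (real_arith R) l r t).2.2).
Proof.
rewrite /closures.
case: (orientation _) => [[s1 s2] s3]; case: (orientation _) => [[s1' s2'] s3'].
move=> Bpos Apos.
have B := @chain_closure_continuous _ _ _ _ _ _ Bpos.
have A := @chain_closure_continuous _ _ _ _ _ _ Apos.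
exact: tends_comp B A.
Qed.

Lemma ival_in_div z : ival_in (zr R z / scale R) (z, z).
Proof. by rewrite /ival_in divfK ?lexx// gt_eqF ?scale_gt0. Qed.

Lemma root_exists l r : near_data l -> bracket_ok r ->
  exists t, let c := closures (real_arith R) l r t in
    [/\ forall x, x \in c.1.1 -> 0 < x, forall x, x \in c.2.1 -> 0 < x,
        c.2.2 = t, ival_in t (bracket_box r).1 & ival_in c.1.2 (bracket_box r).2].
Proof.
move=> lI /and5P[/Z.leb_le lohiZ posT posa posb sgn].
have lohi := zr_le R lohiZ.
have s0 := scale_gt0 R.
pose a := zr R (bracket_lo r) / scale R; pose b := zr R (bracket_hi r) / scale R.
have ab : a <= b by rewrite ler_pM2r ?invr_gt0.
have inT t : t \in `[a, b] -> ival_in t (bracket_lo r, bracket_hi r).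
  by rewrite in_itv /= /ival_in ler_pdivrMr// ler_pdivlMr.
have cT t tab := closures_in lI (inT t tab) posT.
pose g t := (closures (real_arith R) l r t).2.2 - t.
have gC : {within `[a, b], continuous g}.
  apply: continuous_in_subspaceT => t; rewrite inE/= => tab.
  have [Bpos Apos _ _] := cT t tab.
  by apply: tendsD; [exact: closures_continuous | apply: tendsN; exact: tends_id].
have [_ _ _ fa] := closures_in lI (ival_in_div _) posa.
have [_ _ _ fb] := closures_in lI (ival_in_div _) posb.
rewrite -/a -/b in fa fb.
have bounds x c : ival_in x c -> zr R c.1 / scale R <= x /\ x <= zr R c.2 / scale R.
  by rewrite ler_pdivrMr// ler_pdivlMr// => /andP[].
have le_zr z z' : Z.le z z' -> zr R z / scale R <= zr R z' / scale R.
  by move=> h; rewrite ler_pM2r ?invr_gt0//; exact: zr_le.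
have zero : Num.min (g a) (g b) <= 0 <= Num.max (g a) (g b).
  have [fa1 fa2] := bounds _ _ fa; have [fb1 fb2] := bounds _ _ fb.
  rewrite ge_min le_max !subr_le0 !subr_ge0.
  case/orP: sgn => /andP[/Z.leb_le/le_zr h1 /Z.leb_le/le_zr h2].
    by rewrite (le_trans fa2 h2) (le_trans h1 fb1) orbT.
  by rewrite (le_trans h1 fa1) (le_trans fb2 h2) orbT.
have [t tab /eqP] := IVT ab gC zero; rewrite subr_eq0 => /eqP gt.
by exists t; have [? ? ? ?] := cT t tab; split => //; exact: inT.
Qed.

Lemma roots_realized l : near_data l ->
  forall i, (i < 66)%N -> exists q, root_realization l i q.
Proof.
move=> lI i i66; pose r := nth (Bracket 0 0 0 0) brackets i.
have rok : bracket_ok r by apply: (elimT (all_nthP _) brackets_ok); rewrite size_brackets.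
have boxE : nth_box i = bracket_box r.
  by rewrite /nth_box (nth_map (Bracket 0 0 0 0)) ?size_brackets.
clearbody r.
have [t] := root_exists lI rok; rewrite /closures.
case: (orientation _) => [[s1 s2] s3]; case: (orientation _) => [[s1' s2'] s3'].
move=> [Bpos Apos At tI uI].
have [q [len q14 q03 det]] := disphenoid_realization Bpos Apos At.
exists q; split=> //; rewrite boxE ?q14 ?q03//.
Qed.

Lemma block_exists (k r : nat) :
  block (@near_triangle R) (5 * k + r) (132 ^ k * 2 ^ r).
Proof.
elim: k => [|k IHk]; last first.
  rewrite mulnS -addnA expnS -mulnA; apply: block_glue => //.
  exact/block_disphenoid/roots_realized.
rewrite muln0 mul1n add0n; elim: r => [|r IHr]; first exact: block0.
rewrite -add1n expnD expn1; apply: block_glue => //.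
exact: block_apex (@near_triangle_bounds R).
Qed.
End RootExistence.

(** * Congruence and frame coordinates *)

Section Congruence.
Context (R : realFieldType).
Implicit Types (x y z t : 'rV[R]_3) (A E : 'M[R]_3) (a b c w : point R).

Definition pt x : point R := (x 0 0, x 0 1, x 0 (1 + 1)).
Definition rv a : 'rV[R]_3 := \row_(k < 3) nth 0 [:: a.1.1; a.1.2; a.2] k.
Definition mx3 a b c : 'M[R]_3 :=
  \matrix_(i < 3) rv (nth (0, 0, 0) [:: a; b; c] i).

Lemma rvK a : pt (rv a) = a.
Proof. by case: a => [[? ?] ?]; rewrite /pt !mxE. Qed.

Lemma ord3P (k : 'I_3) : [\/ k = 0, k = 1 | k = 1 + 1].
Proof.
case: k => [[|[|[|?]]] ?] //; [apply: Or31 | apply: Or32 | apply: Or33];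
  exact: val_inj.
Qed.

Lemma ptK x : rv (pt x) = x.
Proof.
apply/rowP => k; rewrite !mxE; by case: (ord3P k) => ->.
Qed.

Lemma ptB x y : pt (x - y) = sub3 (pt x) (pt y).
Proof. by rewrite /pt !mxE. Qed.

Lemma sum3 (F : 'I_3 -> R) : \sum_k F k = F 0 + F 1 + F (1 + 1).
Proof.
rewrite !big_ord_recl big_ord0 addr0 addrA.
by congr (_ + F _ + F _); apply: val_inj.
Qed.

Lemma dot3_mx x y : dot3 (pt x) (pt y) = (x *m y^T) 0 0.
Proof. by rewrite /dot3 mxE sum3 !mxE. Qed.

Lemma det_mx3 a b c : \det (mx3 a b c) = det3 a b c.
Proof.
case: a b c => [[a1 a2] a3] [[b1 b2] b3] [[c1 c2] c3].
rewrite (expand_det_row _ 0) sum3 /cofactor.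
rewrite !(expand_det_row _ 0) !big_ord_recl !big_ord0 /cofactor !det_mx11.
rewrite /det3 /cross3 /dot3 !mxE /=; ring.
Qed.

Lemma mx3M x y z A :
  mx3 (pt x) (pt y) (pt z) *m A = mx3 (pt (x *m A)) (pt (y *m A)) (pt (z *m A)).
Proof.
apply/row_matrixP => i; rewrite row_mul !rowK.
by case: (ord3P i) => -> /=; rewrite !ptK.
Qed.

Lemma dot3_isometry x y A : A *m A^T = 1%:M ->
  dot3 (pt (x *m A)) (pt (y *m A)) = dot3 (pt x) (pt y).
Proof.
by move=> AA; rewrite !dot3_mx trmx_mul mulmxA -(mulmxA x) AA mulmx1.
Qed.

Lemma det3_isometry x y z A : \det A = 1 ->
  det3 (pt (x *m A)) (pt (y *m A)) (pt (z *m A)) = det3 (pt x) (pt y) (pt z).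
Proof. by move=> A1; rewrite -!det_mx3 -mx3M det_mulmx A1 mulr1. Qed.

Lemma dist2_dot a b : dist2 a b = dot3 (sub3 a b) (sub3 a b).
Proof. by rewrite /dist2 /dot3 /sub3 /= !expr2. Qed.

Lemma frameK a b c w : tri_gram a b c != 0 -> coords a b c (frame a b c w) = w.
Proof.
rewrite /coords /tri_gram polar_dot.
case: a b c w => [[a1 a2] a3] [[b1 b2] b3] [[c1 c2] c3] [[x1 x2] x3].
rewrite /frame /det3 /dist2 /gram2 /dot3 /sub3 /cross3 /= => D0.
by congr ((_, _), _); field.
Qed.

Definition basis a b c : 'M[R]_3 :=
  mx3 (sub3 b a) (sub3 c a) (cross3 (sub3 b a) (sub3 c a)).

Lemma rv_frame a b c w : rv (frame a b c w) = rv a + rv w *m basis a b c.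
Proof.
apply/rowP => k; rewrite !mxE sum3 !mxE /=.
by case: (ord3P k) => -> /=; ring.
Qed.

Lemma det_basis a b c : \det (basis a b c) = tri_gram a b c.
Proof. by rewrite det_mx3 tri_gram_cross. Qed.

Lemma mx3_tr a b c : mx3 a b c *m (mx3 a b c)^T =
  \matrix_(i, j) dot3 (nth (0, 0, 0) [:: a; b; c] i) (nth (0, 0, 0) [:: a; b; c] j).
Proof. by apply/matrixP => i j; rewrite !mxE sum3 !mxE. Qed.

Lemma basis_gram a b c a' b' c' : dist2 a b = dist2 a' b' ->
    dist2 a c = dist2 a' c' -> dist2 b c = dist2 b' c' ->
  basis a b c *m (basis a b c)^T = basis a' b' c' *m (basis a' b' c')^T.
Proof.
move=> ab ac bc.
have orth1 (p q : point R) : dot3 p (cross3 p q) = 0 by rewrite /dot3 /cross3 /=; ring.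
have orth2 (p q : point R) : dot3 q (cross3 p q) = 0 by rewrite /dot3 /cross3 /=; ring.
have dotC (p q : point R) : dot3 p q = dot3 q p by rewrite /dot3; ring.
have d1 : dot3 (sub3 b a) (sub3 b a) = dot3 (sub3 b' a') (sub3 b' a').
  by rewrite -!dist2_dot dist2C ab dist2C.
have d2 : dot3 (sub3 c a) (sub3 c a) = dot3 (sub3 c' a') (sub3 c' a').
  by rewrite -!dist2_dot dist2C ac dist2C.
have d3 : dot3 (sub3 b a) (sub3 c a) = dot3 (sub3 b' a') (sub3 c' a').
  by rewrite -!polar_dot ab ac bc.
rewrite !mx3_tr; apply/matrixP => i j; rewrite !mxE.
case: (ord3P i) => ->; case: (ord3P j) => -> //=.
- by rewrite !orth1.
- by rewrite dotC d3 dotC.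
- by rewrite !orth2.
- by rewrite dotC orth1 dotC orth1.
- by rewrite dotC orth2 dotC orth2.
- by rewrite -!tri_gram_cross /tri_gram ab ac bc.
Qed.

Section Embeddings.
Variables (V : Type) (v0 v1 v2 : V).
Implicit Types (p q : V -> 'rV[R]_3).

Definition frame_coords p (v : V) : point R :=
  coords (pt (p v0)) (pt (p v1)) (pt (p v2)) (pt (p v)).
Definition nondegenerate p : Prop :=
  tri_gram (pt (p v0)) (pt (p v1)) (pt (p v2)) != 0.
Definition same_triangle p q : Prop :=
  [/\ dist2 (pt (p v0)) (pt (p v1)) = dist2 (pt (q v0)) (pt (q v1)),
      dist2 (pt (p v0)) (pt (p v2)) = dist2 (pt (q v0)) (pt (q v2)) &
      dist2 (pt (p v1)) (pt (p v2)) = dist2 (pt (q v1)) (pt (q v2))].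

Lemma rigid_motion_coords p q A t : A *m A^T = 1%:M -> \det A = 1 ->
    (forall v, q v = p v *m A + t) ->
  same_triangle p q /\ frame_coords p =1 frame_coords q.
Proof.
move=> AA A1 pq.
have subE u v : sub3 (pt (q u)) (pt (q v)) = pt ((p u - p v) *m A).
  by rewrite -ptB !pq mulmxBl opprD addrACA subrr addr0.
have distE u v : dist2 (pt (p u)) (pt (p v)) = dist2 (pt (q u)) (pt (q v)).
  by rewrite !dist2_dot subE dot3_isometry// ptB.
split=> // v.
by rewrite /frame_coords /coords /tri_gram !subE !dot3_isometry// det3_isometry//
  !ptB !distE.
Qed.

(** The motion sends one frame to the other. Equal triangles give equal Gram matrices, so it is
    orthogonal; the third vector being a cross product, both frames have determinant [tri_gram], so
    it is a rotation. Frame coordinates therefore distinguish mirror images. *)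
Lemma coords_rigid_motion p q : nondegenerate p ->
    same_triangle p q -> frame_coords p =1 frame_coords q ->
  exists A t, [/\ A *m A^T = 1%:M, \det A = 1 & forall v, q v = p v *m A + t].
Proof.
move=> D0 [d1 d2 d3] cpq.
pose E := basis (pt (p v0)) (pt (p v1)) (pt (p v2)).
pose E' := basis (pt (q v0)) (pt (q v1)) (pt (q v2)).
have detE : \det E' = \det E by rewrite !det_basis /tri_gram d1 d2 d3.
have Eu : E \in unitmx by rewrite unitmxE det_basis unitfE.
have EE : E' *m E'^T = E *m E^T by apply: basis_gram.
exists (invmx E *m E'), (q v0 - p v0 *m (invmx E *m E')); split.
- rewrite trmx_mul mulmxA -(mulmxA (invmx E)) EE mulmxA mulVmx// mul1mx.
  by rewrite -trmx_mul mulVmx// trmx1.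
- by rewrite det_mulmx det_inv detE mulVr// -unitmxE.
move=> v; have D0' : nondegenerate q by move: D0; rewrite /nondegenerate /tri_gram d1 d2 d3.
have pE : p v = p v0 + rv (frame_coords p v) *m E.
  by rewrite -[p v0]ptK -rv_frame coordsK// ptK.
have qE : q v = q v0 + rv (frame_coords p v) *m E'.
  by rewrite cpq -[q v0 in RHS]ptK -rv_frame coordsK// ptK.
rewrite qE {1}pE mulmxDl -[_ *m E *m _]mulmxA mulKVmx//.
by rewrite [in RHS]addrC -addrA addKr.
Qed.
End Embeddings.
End Congruence.

Lemma triangle_exists (R : rcfType) (a b g : R) : 0 < a -> 0 < gram2 a b g ->
  exists A B C : point R, [/\ dist2 A B = a, dist2 A C = b &
    polar a b (dist2 B C) = g].
Proof.
move=> a0 D0; pose h := Num.sqrt a; pose k := Num.sqrt (gram2 a b g).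
have hh : h ^+ 2 = a by rewrite sqr_sqrtr ?ltW.
have kk : k ^+ 2 = gram2 a b g by rewrite sqr_sqrtr ?ltW.
have h0 : h != 0 by rewrite gt_eqF ?sqrtr_gt0.
exists (0, 0, 0), (h, 0, 0), (g / h, k / h, 0); rewrite /polar /dist2 /=; split.
- by rewrite -hh; ring.
- rewrite !sub0r !sqrrN !exprMn !exprVn hh kk expr0n addr0 /gram2.
  by field; rewrite gt_eqF.
have -> : (h - g / h) ^+ 2 + (0 - k / h) ^+ 2 + (0 - 0) ^+ 2 =
    h ^+ 2 - 2 * g + (g ^+ 2 + k ^+ 2) / h ^+ 2 by field.
by rewrite hh kk /gram2; field; rewrite gt_eqF.
Qed.

Lemma finite_roots (R : idomainType) (p : {poly R}) : p != 0 ->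
  exists s : seq R, forall x, root p x -> x \in s.
Proof.
have [n] := ubnP (size p); elim: n p => // n IHn p /ltnSE pn p0.
have [[x px]|nox] := EM (exists x, root p x); last first.
  by exists [::] => x px; case: nox; exists x.
have /factor_theorem[r rE] := px; have r0 : r != 0.
  by apply: contraNneq p0 => r0; rewrite rE r0 mul0r.
have [|s sP] := IHn r _ r0.
  by move: pn; rewrite rE size_Mmonic ?monicXsubC// size_XsubC addn2.
exists (x :: s) => y; rewrite rE rootM root_XsubC inE => /orP[/sP -> |->//].
by rewrite orbT.
Qed.

Lemma finite_zeros (R : idomainType) (N : nat) (c : nat -> R) :
    (exists k : 'I_N, c k != 0) ->
  exists s : seq R, forall x, \sum_(k < N) c k * x ^+ k = 0 -> x \in s.
Proof.
move=> [k ck]; have [|s sP] := @finite_roots _ (\poly_(k < N) c k).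
  apply: contraNneq ck => p0; have <- : (\poly_(k < N) c k)`_k = c k.
    by rewrite coef_poly ltn_ord.
  by rewrite p0 coef0.
by exists s => x x0; apply: sP; rewrite /root horner_poly x0.
Qed.

(** * Shape variables and edge polynomials *)

Notation shape_var W := ('I_3 + W * 'I_3)%type.

Section Shape.
Context (W : finType).
Implicit Types (K : realFieldType) (uv : ('I_3 + W) * ('I_3 + W)).

Definition shape_coords K (x : {ffun shape_var W -> K}) (w : W) : point K :=
  (x (inr (w, 0)), x (inr (w, 1)), x (inr (w, 1 + 1))).

(** The variables are two squared sides of the triangle, their inner product, and three coordinates
    per further vertex: as many as edges. The third squared side is the value of [quad] at a
    difference (1, -1, 0). *)
Definition edge_poly K uv (x : {ffun shape_var W -> K}) : K :=
  quad (x (inl 0)) (x (inl 1)) (x (inl (1 + 1)))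
    (sub3 (vertex_coords (shape_coords x) uv.1) (vertex_coords (shape_coords x) uv.2)).

Definition make_shape K (a b g : K) (w : W -> point K) : {ffun shape_var W -> K} :=
  [ffun i : shape_var W => match i with
    | inl k => nth 0 [:: a; b; g] k
    | inr (v, k) => nth 0 [:: (w v).1.1; (w v).1.2; (w v).2] k end].

Lemma make_shapeK K (a b g : K) w : shape_coords (make_shape a b g w) =1 w.
Proof. by move=> v; rewrite /shape_coords !ffunE /=; case: (w v) => [[? ?] ?]. Qed.

Lemma sep_poly_edge K uv : sep_poly 4 (@edge_poly K uv).
Proof.
pose c' v (x : {ffun shape_var W -> K}) := vertex_coords (shape_coords x) v.
have coord v : [/\ sep_poly 1 (fun x => (c' v x).1.1),
    sep_poly 1 (fun x => (c' v x).1.2) & sep_poly 1 (fun x => (c' v x).2)].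
  case: v => [k|v] /=; split; do ?exact: sep_poly_cst; exact: sep_poly_proj.
case: uv => u v; have [u1 u2 u3] := coord u; have [v1 v2 v3] := coord v.
have d1 := sep_polyD u1 (sep_polyN v1).
have d2 := sep_polyD u2 (sep_polyN v2).
have d3 := sep_polyD u3 (sep_polyN v3).
pose c i := @sep_poly_proj K (shape_var W) (inl i).
have A := sep_polyM (sep_polyX 2 d1) (c 0).
have B := sep_polyM (sep_polyM (@sep_poly_cst K (shape_var W) 0 2)
  (sep_polyM d1 d2)) (c (1 + 1)).
have C := sep_polyM (sep_polyX 2 d2) (c 1).
have D := sep_polyM (sep_polyX 2 d3)
  (sep_polyD (sep_polyM (c 0) (c 1)) (sep_polyN (sep_polyX 2 (c (1 + 1))))).
have ABC := sep_poly_le (isT : (3 <= 4)%N) (sep_polyD (sep_polyD A B) C).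
exact: sep_polyD ABC D.
Qed.

(** In this form the rationality of the coefficients enters the elimination. *)
Lemma edge_poly_ratr K uv (x : {ffun shape_var W -> rat}) :
  edge_poly uv [ffun i => ratr (x i)] = ratr (edge_poly uv x) :> K.
Proof.
pose r (a : point rat) : point K := (ratr a.1.1, ratr a.1.2, ratr a.2).
have coordE v : vertex_coords (shape_coords [ffun i => ratr (x i)]) v =
    r (vertex_coords (shape_coords x) v).
  case: v => [k|v] /=; first by rewrite /r /= !rmorph_nat rmorph0.
  by rewrite /shape_coords !ffunE.
rewrite /edge_poly !coordE !ffunE.
rewrite /quad /gram2 /sub3 /r /= !(rmorphXn, rmorph_nat, rmorphB, rmorphD, rmorphM).
by [].
Qed.
End Shape.

(** * Continuity of frame coordinates *)

Section PointContinuity.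
Context (R : realType) (F : set_system R) {FF : Filter F} (t : R).
Implicit Types (f g h : R -> point R).

Definition tends3 f : Prop :=
  [/\ tends F t (fun s => (f s).1.1), tends F t (fun s => (f s).1.2) &
      tends F t (fun s => (f s).2)].

Lemma tends3_sub f g : tends3 f -> tends3 g -> tends3 (fun s => sub3 (f s) (g s)).
Proof.
by move=> [? ? ?] [? ? ?]; split; apply: tendsD => //; apply: tendsN.
Qed.

Lemma tends3_dot f g : tends3 f -> tends3 g -> tends F t (fun s => dot3 (f s) (g s)).
Proof.
move=> [? ? ?] [? ? ?]; apply: tendsD; last exact: tendsM.
by apply: tendsD; apply: tendsM.
Qed.

Lemma tends3_cross f g : tends3 f -> tends3 g -> tends3 (fun s => cross3 (f s) (g s)).
Proof.
move=> [? ? ?] [? ? ?]; split; (apply: tendsD; first exact: tendsM);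
  by apply: tendsN; apply: tendsM.
Qed.

Lemma tends3_dist2 f g : tends3 f -> tends3 g -> tends F t (fun s => dist2 (f s) (g s)).
Proof.
move=> /tends3_sub fg /fg [? ? ?]; apply: tendsD; last exact: tendsX.
by apply: tendsD; apply: tendsX.
Qed.

Lemma tends_polar (u v w : R -> R) : tends F t u -> tends F t v -> tends F t w ->
  tends F t (fun s => polar (u s) (v s) (w s)).
Proof.
move=> *; apply: tendsM; last exact: tends_cst.
by apply: tendsD; [exact: tendsD | exact: tendsN].
Qed.

Lemma tends3_coords (a b c x : R -> point R) :
    tends3 a -> tends3 b -> tends3 c -> tends3 x ->
    tri_gram (a t) (b t) (c t) != 0 ->
  tends3 (fun s => coords (a s) (b s) (c s) (x s)).
Proof.
move=> ta tb tc tx D0.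
have e1 := tends3_sub tb ta; have e2 := tends3_sub tc ta.
have w := tends3_sub tx ta.
have l1 := tends3_dist2 ta tb; have l2 := tends3_dist2 ta tc.
have D : tends F t (fun s => (tri_gram (a s) (b s) (c s))^-1).
  apply: tendsV => //; apply: tendsD; first exact: tendsM.
  by apply: tendsN; apply: tendsX; apply: tends_polar => //; exact: tends3_dist2.
have g := tends3_dot e1 e2; have w1 := tends3_dot w e1; have w2 := tends3_dot w e2.
split; apply: tendsM => //; last by apply: tends3_dot => //; exact: tends3_cross.
  by apply: tendsD; [exact: tendsM | apply: tendsN; exact: tendsM].
by apply: tendsD; [exact: tendsM | apply: tendsN; exact: tendsM].
Qed.
End PointContinuity.

(** If [f t] differed from [f 0], the intermediate value theorem would produce more values between
    them than [s] has elements. *)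
Lemma finite_valued_constant (R : realType) (f : R -> R) (s : seq R) :
    {within `[0, 1], continuous f} -> (forall t, t \in `[0, 1]%R -> f t \in s) ->
  forall t, t \in `[0, 1]%R -> f t = f 0.
Proof.
move=> fC fs t; rewrite in_itv /= => /andP[t0 t1]; apply/eqP; apply/negP => /negP ft.
have lt : Num.min (f 0) (f t) < Num.max (f 0) (f t).
  by move: ft; rewrite eq_sym; case: (ltgtP (f 0) (f t)).
have [r [ur sr rP]] := interval_points (size s).+1 lt.
suff /(uniq_leq_size ur) : {subset r <= s} by rewrite sr ltnn.
move=> y /rP /andP[ly yh].
have sub : `[0, t] `<=` `[0, 1]%classic.
  by move=> x /=; rewrite !in_itv /= => /andP[-> /le_trans -> //].
have [x xt <-] := IVT t0 (continuous_subspaceW sub fC)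
  (ltac:(by rewrite (ltW ly) (ltW yh)) : Num.min (f 0) (f t) <= y <= Num.max (f 0) (f t)).
by apply: fs; move: xt; rewrite !in_itv /= => /andP[-> /le_trans -> //].
Qed.

(** * Rigidity and number of embeddings *)

Section FamilyGraph.
Context (R : realType) (V W F : finType).
Variables (vertex : 'I_3 + W -> V) (vcode : V -> 'I_3 + W).
Hypotheses (vertexK : cancel vertex vcode) (vcodeK : cancel vcode vertex).
Variable ends : F -> ('I_3 + W) * W.
Hypothesis ends_simple : simple ends.

Definition triangle_ends (k : 'I_3) : ('I_3 + W) * ('I_3 + W) :=
  (inl (nth 0 [:: 0; 0; 1] k), inl (nth 0 [:: 1; 1 + 1; 1 + 1] k)).
Definition all_ends (i : 'I_3 + F) : ('I_3 + W) * ('I_3 + W) :=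
  match i with
  | inl k => triangle_ends k
  | inr f => ((ends f).1, inr (ends f).2)
  end.

Lemma all_ends_neq i : (all_ends i).1 <> (all_ends i).2.
Proof.
case: i => [k|f] /=; last by case: ends_simple.
by case: (ord3P k) => -> /= [].
Qed.

Lemma all_ends_inj i j : all_ends i = all_ends j \/
  (all_ends i).1 = (all_ends j).2 /\ (all_ends j).1 = (all_ends i).2 -> i = j.
Proof.
case: i j => [k|f] [k'|f'] /=.
- case: (ord3P k) => ->; case: (ord3P k') => -> // [/eqP //|[/eqP h1 /eqP h2]];
    by move: h1 h2.
- by case=> [[]|[]].
- by case=> [[]|[]].
by move=> h; congr inr; apply: ends_simple.2; case: h => [[ff e]|[]]; [left|right] => //;
  move: ff e; case: (ends f) (ends f') => [? ?] [? ?] /= -> ->.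
Qed.

Definition edge_set i : {set V} := [set vertex (all_ends i).1; vertex (all_ends i).2]%SET.

Lemma vertex_inj : injective vertex.
Proof. exact: can_inj vertexK. Qed.

Lemma set2_eq (T : finType) (a b u v : T) : a <> b ->
  [set a; b]%SET = [set u; v]%SET -> (a, b) = (u, v) \/ (a, b) = (v, u).
Proof.
move=> ab E.
have /set2P ha : a \in [set u; v]%SET by rewrite -E set21.
have /set2P hb : b \in [set u; v]%SET by rewrite -E set22.
move=> {E}; case: ha ab => -> ab; case: hb ab => -> ab;
  first [by left | by right | by case: ab].
Qed.

Lemma edge_set_inj : injective edge_set.
Proof.
move=> i j /set2_eq [] =>
  [/vertex_inj|[] /vertex_inj e1 /vertex_inj e2|[] /vertex_inj e1 /vertex_inj e2].
- exact: all_ends_neq.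
- apply: all_ends_inj; left; move: e1 e2.
  by case: (all_ends i) (all_ends j) => [? ?] [? ?] /= -> ->.
- by apply: all_ends_inj; right.
Qed.

Lemma card_edge_set e : e \in [set edge_set i | i in [set: 'I_3 + F]]%SET -> #|e| = 2%N.
Proof.
move=> /imsetP[i _ ->]; rewrite cards2; case: eqP => // /vertex_inj.
by move/all_ends_neq.
Qed.

Definition family_graph : sgraph V := SGraph card_edge_set.

Definition mk_edge i : edge family_graph :=
  exist _ (edge_set i) (imset_f edge_set (finset.in_setT i)).

Lemma edge_index_subproof (e : edge family_graph) : {i | edge_set i = val e}.
Proof. by apply: cid; have /imsetP[i _ ->] := valP e; exists i. Qed.

Definition edge_index (e : edge family_graph) : 'I_3 + F := sval (edge_index_subproof e).

Lemma edge_indexK : cancel edge_index mk_edge.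
Proof. by move=> e; apply: val_inj; exact: (svalP (edge_index_subproof e)). Qed.

Lemma mk_edgeK : cancel mk_edge edge_index.
Proof. by move=> i; apply: edge_set_inj; exact: (svalP (edge_index_subproof _)). Qed.

Lemma card_edge : #|{: edge family_graph}| = (3 + #|F|)%N.
Proof.
rewrite -[3%N]card_ord -card_sum; apply: bij_eq_card; exists mk_edge.
  exact: edge_indexK.
exact: mk_edgeK.
Qed.

Lemma edist_dist2 (x y : 'rV[R]_3) : edist x y = Num.sqrt (dist2 (pt x) (pt y)).
Proof. by rewrite /edist sum3. Qed.

Lemma compatible_dist2 (d : edge family_graph -> R) p : compatible d p ->
  forall e, let uv := all_ends (edge_index e) in
    dist2 (pt (p (vertex uv.1))) (pt (p (vertex uv.2))) = d e ^+ 2.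
Proof.
move=> dp e uv; rewrite -(dp e (vertex uv.1) (vertex uv.2)).
  by rewrite edist_dist2 sqr_sqrtr// dist2_ge0.
exact/esym/(svalP (edge_index_subproof e)).
Qed.

Lemma dist2_compatible (d : edge family_graph -> R) (p : V -> 'rV[R]_3) :
    (forall e, 0 <= d e) ->
    (forall e, let uv := all_ends (edge_index e) in
      dist2 (pt (p (vertex uv.1))) (pt (p (vertex uv.2))) = d e ^+ 2) ->
  compatible d p.
Proof.
move=> d0 dp e u v; rewrite -(svalP (edge_index_subproof e)) => /set2_eq.
have := dp e; rewrite edist_dist2 -/(edge_index e) /=; set uv := all_ends _ => dE [].
- by move/vertex_inj; exact: all_ends_neq.
- by move=> [<- <-]; rewrite dE sqrtr_sqr ger0_norm.
- by move=> [<- <-]; rewrite dist2C dE sqrtr_sqr ger0_norm.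
Qed.

Local Notation v0 := (vertex (inl 0)).
Local Notation v1 := (vertex (inl 1)).
Local Notation v2 := (vertex (inl (1 + 1))).
Local Notation nondeg p := (nondegenerate v0 v1 v2 p).
Implicit Types p q : embedding R V.

(** A complete invariant up to rotation and translation, as long as the triangle is
    nondegenerate. *)
Definition shape p : {ffun shape_var W -> R} :=
  let l1 := dist2 (pt (p v0)) (pt (p v1)) in
  let l2 := dist2 (pt (p v0)) (pt (p v2)) in
  make_shape l1 l2 (polar l1 l2 (dist2 (pt (p v1)) (pt (p v2))))
    (fun w => frame_coords v0 v1 v2 p (vertex (inr w))).

Lemma frame_coords_vertex p u : nondeg p ->
  frame_coords v0 v1 v2 p (vertex u) = vertex_coords (shape_coords (shape p)) u.
Proof.
move=> D0; case: u => [k|w] /=; last by rewrite make_shapeK.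
have [c0 c1 c2] := coords_base D0.
by rewrite /frame_coords; case: (ord3P k) => -> /=; rewrite ?c0 ?c1 ?c2.
Qed.

Lemma dist2_edge_poly p u v : nondeg p ->
  dist2 (pt (p (vertex u))) (pt (p (vertex v))) = edge_poly (u, v) (shape p).
Proof.
move=> D0; rewrite (coords_dist2 _ _ D0) /edge_poly !ffunE.
by rewrite -!frame_coords_vertex.
Qed.

Lemma congruent_shape p q : congruent p q -> shape p = shape q.
Proof.
move=> [A [t [AA A1 pq]]].
have [[d1 d2 d3] c] := rigid_motion_coords v0 v1 v2 AA A1 pq.
by rewrite /shape d1 d2 d3; congr make_shape; apply/funext => w; exact: c.
Qed.

Lemma shape_congruent p q : nondeg p -> shape p = shape q -> congruent p q.
Proof.
move=> D0 pq.
have pqi i : shape p i = shape q i by rewrite pq.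
have := pqi (inl 0); have := pqi (inl 1); have := pqi (inl (1 + 1)).
rewrite !ffunE /= => d3 d2 d1.
have {}d3 : dist2 (pt (p v1)) (pt (p v2)) = dist2 (pt (q v1)) (pt (q v2)).
  by move: d3; rewrite /polar d1 d2; lra.
have D0' : nondeg q by move: D0; rewrite /nondegenerate /tri_gram d1 d2 d3.
apply: (coords_rigid_motion D0) => // v.
by rewrite -(vcodeK v) !frame_coords_vertex// pq.
Qed.

Lemma shape_realization (a b g : R) (w : W -> point R) :
  0 < a -> 0 < gram2 a b g ->
  exists p, nondeg p /\ shape p = make_shape a b g w.
Proof.
move=> a0 D0; have [A [B [C [AB AC BC]]]] := triangle_exists a0 D0.
have N0 : tri_gram A B C != 0.
  by rewrite /tri_gram AB AC BC gt_eqF.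
pose p v := rv (frame A B C (vertex_coords w (vcode v))).
have pE u : pt (p (vertex u)) = frame A B C (vertex_coords w u) by rewrite rvK vertexK.
have p0 : pt (p v0) = A by rewrite pE frame0.
have p1 : pt (p v1) = B by rewrite pE frame1.
have p2 : pt (p v2) = C by rewrite pE frame2.
exists p; split; first by rewrite /nondegenerate p0 p1 p2.
rewrite /shape p0 p1 p2 AB AC BC; congr make_shape; apply/funext => x.
by rewrite /frame_coords p0 p1 p2 pE frameK.
Qed.

Local Notation G := family_graph.
Local Notation e01 := (mk_edge (inl 0)).
Local Notation e02 := (mk_edge (inl 1)).
Local Notation e12 := (mk_edge (inl (1 + 1))).

Definition edge_gram (z : edge G -> R) : R :=
  gram2 (z e01) (z e02) (polar (z e01) (z e02) (z e12)).

Lemma compatible_triangle d p : compatible d p ->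
  [/\ dist2 (pt (p v0)) (pt (p v1)) = d e01 ^+ 2,
      dist2 (pt (p v0)) (pt (p v2)) = d e02 ^+ 2 &
      dist2 (pt (p v1)) (pt (p v2)) = d e12 ^+ 2].
Proof.
move=> /compatible_dist2 H.
by split; rewrite -H mk_edgeK.
Qed.

Lemma compatible_nondegenerate d p : compatible d p ->
  edge_gram (fun e => d e ^+ 2) != 0 -> nondeg p.
Proof.
by move=> /compatible_triangle[d1 d2 d3]; rewrite /nondegenerate /tri_gram d1 d2 d3.
Qed.

(** Degeneracy of the triangle is a polynomial condition over the rationals, so generic lengths
    avoid it. The factor 4 clears the halves in [polar]. *)
Lemma edge_gram_mpoly : exists P : mpoly.mpoly #|{: edge G}| rat,
  forall z : edge G -> R, rat_eval P z = 4 * edge_gram z.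
Proof.
pose X e : mpoly.mpoly #|{: edge G}| rat := mpoly.mpolyX rat (mpoly.mnm1 (enum_rank e)).
exists (4%:R * X e01 * X e02 - (X e01 + X e02 - X e12) ^+ 2) => z.
pose ev : {rmorphism mpoly.mpoly #|{: edge G}| rat -> R} :=
  mpoly.mmap ratr (fun i => z (enum_val i)).
have evX e : ev (X e) = z e by rewrite [LHS]mpoly.mmapX mpoly.mmap1U enum_rankK.
transitivity (ev (4%:R * X e01 * X e02 - (X e01 + X e02 - X e12) ^+ 2)); first by [].
rewrite rmorphB rmorphXn rmorphB rmorphD !rmorphM rmorph_nat !evX.
by rewrite /edge_gram /gram2 /polar; field.
Qed.

Section Fibre.
Variables (N : shape_var W -> nat)
  (Q : shape_var W -> nat -> mpoly.mpoly #|{: edge G}| rat).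
Hypothesis relation : forall (x : {ffun shape_var W -> R}) i,
  \sum_(k < N i) rat_eval (Q i k) (fun e => edge_poly (all_ends (edge_index e)) x) *
    x i ^+ k = 0.

Definition regular (z : edge G -> R) : Prop :=
  edge_gram z != 0 /\ forall i, exists k : 'I_(N i), rat_eval (Q i k) z != 0.

Lemma shape_values (d : edge G -> R) : regular (fun e => d e ^+ 2) ->
  exists s : seq R, forall p, compatible d p -> forall i, shape p i \in s.
Proof.
move=> [D0 nz].
have /fin_all_exists[s sP] : forall i, exists s : seq R, forall x,
    \sum_(k < N i) rat_eval (Q i k) (fun e => d e ^+ 2) * x ^+ k = 0 -> x \in s.
  move=> i; exact: (finite_zeros (c := fun k => rat_eval (Q i k) _) (nz i)).
exists (flatten [seq s i | i <- enum {: shape_var W}]) => p dp i.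
apply/flattenP; exists (s i); first by apply: map_f; rewrite mem_enum.
apply: sP; rewrite -[RHS](relation (shape p) i); apply: eq_bigr => k _.
congr (rat_eval _ _ * _); apply/funext => e.
have np := compatible_nondegenerate dp D0.
by rewrite -(compatible_dist2 dp) dist2_edge_poly//; case: (all_ends _).
Qed.

Lemma finite_classes (d : edge G -> R) :
  regular (fun e => d e ^+ 2) -> finite_set (classes d).
Proof.
move=> gd; have [s sP] := shape_values gd.
pose K p : {ffun shape_var W -> 'I_(size s).+1} := [ffun i => inord (index (shape p i) s)].
have KE p q : compatible d p -> compatible d q -> K p = K q ->
    [set r | congruent p r] = [set r | congruent q r].
  move=> dp dq /ffunP Kpq.
  have pq : shape p = shape q.
    apply/ffunP => i; have := Kpq i.
    rewrite [K p i]ffunE [K q i]ffunE => /(congr1 (@nat_of_ord _)).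
    rewrite !inordK ?ltnS ?index_size// => /(congr1 (nth 0 s)).
    by rewrite !nth_index ?(sP _ dp) ?(sP _ dq).
  have np := compatible_nondegenerate dp gd.1.
  have nq := compatible_nondegenerate dq gd.1.
  apply/seteqP; split=> r /= /congruent_shape.
    by rewrite pq => h; apply: shape_congruent.
  by rewrite -pq => h; apply: shape_congruent.
(* Each code [k] is sent to the class of a chosen embedding with that code; [set0] is a default for
   codes that do not occur. *)
pose c (k : {ffun shape_var W -> 'I_(size s).+1}) : set (embedding R V) :=
  if pselect (exists2 p, compatible d p & K p = k) is left h
  then [set r | congruent (sval (cid2 h)) r] else set0.
apply: (@sub_finite_set _ _ (c @` setT)); last exact/finite_image/finite_finset.
move=> _ [p dp <-]; exists (K p) => //; rewrite /c; case: pselect => [h|[]].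
  by case: (cid2 h) => q dq Kq /=; apply: KE.
by exists p.
Qed.

Lemma shape_path_continuous (g : R -> embedding R V) :
    (forall v, {within `[0, 1], continuous (fun t => g t v)}) ->
    (forall t, t \in `[0, 1]%R -> nondeg (g t)) ->
  forall i, {within `[0, 1], continuous (fun t => shape (g t) i)}.
Proof.
move=> gC gn i; apply/subspace_continuousP => t /= t01.
have [T TE FT] : exists2 T, T = within `[0, 1]%classic (nbhs t) & Filter T.
  by eexists; [reflexivity | exact: within_filter].
have C v k : tends T t (fun s => g s v 0 k).
  move: (gC v) => /subspace_continuousP /(_ t t01); rewrite -TE => gv.
  apply: (@cvg_comp _ _ _ (fun s => g s v) (fun M : 'rV[R]_3 => M 0 k) _ _ _ gv).
  exact: coord_continuous.
have P v : tends3 T t (fun s => pt (g s v)) by split; exact: C.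
have dP u v := tends3_dist2 (FF := FT) (P u) (P v).
have E x : shape (g x) i = match i with
    | inl k => nth 0 [:: dist2 (pt (g x v0)) (pt (g x v1)); dist2 (pt (g x v0)) (pt (g x v2));
        polar (dist2 (pt (g x v0)) (pt (g x v1))) (dist2 (pt (g x v0)) (pt (g x v2)))
          (dist2 (pt (g x v1)) (pt (g x v2)))] k
    | inr (w, k) => let c := frame_coords v0 v1 v2 (g x) (vertex (inr w)) in
        nth 0 [:: c.1.1; c.1.2; c.2] k end by rewrite ffunE.
suff : tends T t (fun x => shape (g x) i) by rewrite TE.
rewrite (funext E); case: i {E} => [k|[w k]].
  by case: (ord3P k) => -> //=; apply: (tends_polar (FF := FT)).
have [c1 c2 c3] := tends3_coords (FF := FT) (P v0) (P v1) (P v2)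
  (P (vertex (inr w))) (gn _ t01).
by case: (ord3P k) => -> /=.
Qed.

(** One realizable regular length vector is enough: a rational polynomial that vanishes at generic
    lengths vanishes at all realizable ones, so whatever is nonzero at [d0] stays nonzero at every
    generic [d]. *)
Lemma rigid_of_regular (d0 : edge G -> R) p0 :
  compatible d0 p0 -> regular (fun e => d0 e ^+ 2) -> rigid R G.
Proof.
move=> cp0 [D0 nz0] d dpos dgen p dp [g [gC g0 gcomp [t t01]]]; apply.
have sqE P (z : edge G -> R) : sq_eval P z = rat_eval P (fun e => z e ^+ 2) by [].
have gd : regular (fun e => d e ^+ 2).
  split.
    have [P PE] := edge_gram_mpoly.
    apply: contra_neq D0 => Dd; have := dgen P; rewrite sqE PE Dd mulr0.
    move=> /(_ erefl _ _ cp0); rewrite sqE PE => /eqP.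
    by rewrite mulf_eq0 pnatr_eq0 => /eqP.
  move=> i; have [k qk] := nz0 i; exists k; apply: contra_neq qk => qk.
  by have := dgen _ qk _ _ cp0.
have [s sP] := shape_values gd.
have gn x : x \in `[0, 1]%R -> nondeg (g x).
  by move=> /gcomp cx; exact: compatible_nondegenerate cx gd.1.
have i0 : (0 : R) \in `[0, 1]%R by rewrite in_itv /= lexx ler01.
rewrite -g0; apply: shape_congruent; first exact: gn.
apply/ffunP => i; apply/esym.
have fC := shape_path_continuous gC gn (i := i).
have fs x : x \in `[0, 1]%R -> shape (g x) i \in s.
  by move=> x01; apply: sP; exact: gcomp.
exact: finite_valued_constant fC fs _ t01.
Qed.
End Fibre.

Lemma r3_ge (d : edge G -> R) (S : finType) (P : S -> embedding R V) :
    (forall e, 0 < d e) -> finite_set (classes d) -> (forall s, compatible d (P s)) ->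
    injective (shape \o P) ->
  (#|S|%:R%:E <= r3 R G)%E.
Proof.
move=> d0 fin cP inj.
apply: (@le_trans _ _ (r3_at d)%:R%:E); last by apply: ereal_sup_ubound; exists d.
rewrite lee_fin ler_nat cardE.
pose c s := [set q | congruent (P s) q].
have cinj : injective c.
  move=> s s' ss; apply: inj; apply: congruent_shape.
  suff : c s' (P s') by rewrite -ss.
  exists 1%:M, 0; split=> [||v]; rewrite ?trmx1 ?mulmx1 ?det1 ?addr0//.
rewrite -(size_map c); apply: uniq_leq_size; first by rewrite map_inj_uniq ?enum_uniq.
move=> _ /mapP[s _ ->]; rewrite in_fset_set// inE; exists (P s) => //; exact: cP.
Qed.

Lemma family_realization (z : edge G -> R) (w : W -> point R) :
    (forall e, 0 <= z e) -> 0 < z e01 -> 0 < edge_gram z ->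
    realizes ends (z e01) (z e02) (z e12) (fun f => z (mk_edge (inr f))) w ->
  exists p, compatible (fun e => Num.sqrt (z e)) p /\
    shape_coords (shape p) =1 w.
Proof.
move=> z0 a0 D0 wE; have [p [np pE]] := shape_realization w a0 D0.
exists p; split; last by move=> x; rewrite pE make_shapeK.
apply: dist2_compatible => [e|e]; first exact: sqrtr_ge0.
rewrite sqr_sqrtr//= dist2_edge_poly// pE /edge_poly !ffunE.
rewrite -[in RHS](edge_indexK e) (funext (make_shapeK _ _ _ _)).
case: (edge_index e) => [k|f]; last exact: wE.
by case: (ord3P k) => -> /=; rewrite /quad /polar /sub3 /=; field.
Qed.

(** Elimination yields a regular vector [z] somewhere in the box without saying whether it is
    realizable. Since every vector of the box has realizations indexed by [S], so does [z], and this
    one vector gives rigidity, finiteness and the count. *)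
Theorem family_bound (S : finType) (lo hi : F -> R) (tlo thi : 'I_3 -> R) :
    #|F| = (3 * #|W|)%N -> (0 < #|S|)%N ->
    (forall f, 0 <= lo f < hi f) -> (forall k, 0 <= tlo k < thi k) ->
    (forall a b c, tlo 0 < a < thi 0 -> tlo 1 < b < thi 1 ->
        tlo (1 + 1) < c < thi (1 + 1) ->
      0 < gram2 a b (polar a b c) /\
      forall l, (forall f, lo f < l f < hi f) ->
        exists2 q : S -> W -> point R, forall s, realizes ends a b c l (q s) &
          forall s s', q s =1 q s' -> s = s') ->
  rigid R G /\ (#|S|%:R%:E <= r3 R G)%E.
Proof.
move=> FW S0 lohi tlohi sol.
pose elo (e : edge G) := match edge_index e with inl k => tlo k | inr f => lo f end.
pose ehi (e : edge G) := match edge_index e with inl k => thi k | inr f => hi f end.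
have elohi e : 0 <= elo e < ehi e by rewrite /elo /ehi; case: edge_index.
have [||||N [Q [rel [z [zbox nz]]]]] := @generic_fibre R (edge G) (shape_var W) 4
    (fun e => edge_poly (all_ends (edge_index e)))
    (fun e => edge_poly (all_ends (edge_index e))) elo ehi.
- by rewrite card_edge card_sum card_prod !card_ord FW mulnC.
- by move=> e; apply: sep_poly_edge.
- by move=> e x; apply: edge_poly_ratr.
- by move=> e; case/andP: (elohi e).
have zgt e : 0 < z e.
  by have /andP[+ _] := zbox e; apply: le_lt_trans; case/andP: (elohi e).
have ztri k : tlo k < z (mk_edge (inl k)) < thi k.
  by have := zbox (mk_edge (inl k)); rewrite /elo /ehi mk_edgeK.
have [D0 solz] := sol _ _ _ (ztri 0) (ztri 1) (ztri (1 + 1)).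
have [|q qE qinj] := solz (fun f => z (mk_edge (inr f))).
  by move=> f; have := zbox (mk_edge (inr f)); rewrite /elo /ehi mk_edgeK.
have /fin_all_exists[P PE] s := family_realization (fun e => ltW (zgt e)) (zgt _) D0 (qE s).
have zE : (fun e => Num.sqrt (z e) ^+ 2) = z.
  by apply/funext => e; rewrite sqr_sqrtr// ltW.
have gz : regular N Q (fun e => Num.sqrt (z e) ^+ 2).
  by rewrite zE; split=> //; rewrite gt_eqF.
have [s0 _] : exists s, s \in S by exact/card_gt0P.
split; first exact: (rigid_of_regular rel (PE s0).1 gz).
apply: (r3_ge (P := P)) (finite_classes rel gz) _ _ => [e|s|s s' /= ss].
- by rewrite sqrtr_gt0.
- exact: (PE s).1.
by apply: qinj => x; rewrite -(PE s).2 -(PE s').2 ss.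
Qed.
End FamilyGraph.

(** * Asymptotics and assembly of the bound *)

Lemma powR132X5 (R : realType) : ((132 : R) `^ 5^-1) ^+ 5 = 132.
Proof.
by rewrite -powR_mulrn ?powR_ge0// -powRrM mulVf ?pnatr_eq0// powRr1.
Qed.

Lemma embedding_bound_Theta (R : realType) :
  (fun n : nat => (embedding_bound n)%:R : R) =Theta_\oo
        (fun n : nat => ((132 : R) `^ 5^-1) ^+ n).
Proof.
have x5 := powR132X5 R; move: x5 (powR_ge0 (132:R) 5^-1).
set x := _ `^ _; move: x => x x5 x0.
have xgt0 : 0 < x.
  by rewrite lt_neqAle x0 andbT; apply: contra_eq_neq x5 => <-;
    rewrite expr0n/= eq_sym pnatr_eq0.
rewrite eqThetaE; apply/asboolP.
exists (x ^- 7, 1) => /=; first by rewrite ltr01 invr_gt0 exprn_gt0.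
exists 3%N => // n /= n3; have /andP[lo hi] := bound_sandwich x0 x5 n3.
by rewrite normr_nat ger0_norm ?exprn_ge0// mul1r.
Qed.

Lemma max_real_embeddings_ge (R : realType) (n : nat) : (3 <= n)%N ->
  ((embedding_bound n)%:R%:E <= max_real_embeddings R n)%E.
Proof.
move=> n3.
have := @block_exists R ((n - 3) %/ 5) ((n - 3) %% 5).
have -> : (5 * ((n - 3) %/ 5) + (n - 3) %% 5)%N = (n - 3)%N.
  by rewrite mulnC -divn_eq.
rewrite [(132 ^ _ * _)%N]mulnC -/(embedding_bound n).
move=> [W [F [S [ends [lo [hi [Wn FW SN simp [lohi sol]]]]]]]].
have card_n : #|{: 'I_3 + W}| = n by rewrite card_sum card_ord Wn subnKC.
pose vertex u : 'I_n := cast_ord card_n (enum_rank u).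
pose vcode (v : 'I_n) : 'I_3 + W := enum_val (cast_ord (esym card_n) v).
have vertexK : cancel vertex vcode by move=> u; rewrite /vcode cast_ordK enum_rankK.
have vcodeK : cancel vcode vertex by move=> v; rewrite /vertex enum_valK cast_ordKV.
have s0 := scale_gt0 R.
pose tlo (k : 'I_3) := zr R (length_ival k).1 / scale R.
pose thi (k : 'I_3) := zr R (length_ival k).2 / scale R.
have in_ival (k : 'I_3) x : tlo k < x < thi k -> ival_in x (length_ival k).
  by rewrite /tlo /thi ltr_pdivrMr// ltr_pdivlMr// /ival_in => /andP[/ltW-> /ltW->].
have [|||a b c ta tb tc|rig bound] := @family_bound R 'I_n W F vertex vcode vertexK
    vcodeK ends simp S lo hi tlo thi _ _ lohi.
- by rewrite FW Wn.
- by rewrite SN muln_gt0 !expn_gt0.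
- move=> k; apply/andP; split; last first.
    by rewrite /tlo /thi ltr_pM2r ?invr_gt0//; exact/zr_lt/length_ival_lt.
  apply: divr_ge0; last exact: ltW.
  have k18 : (k < 18)%N by apply: leq_trans (ltn_ord k) _.
  exact: zr_ge0 (length_ival_ge0 k18).
- have near : near_triangle a b c.
    by split; [exact: in_ival ta | exact: in_ival tb | exact: in_ival tc].
  have [_ _ _ D5] := near_triangle_bounds near.
  split; first by apply: lt_le_trans D5; rewrite invr_gt0.
  exact: sol.
rewrite -SN; apply: (le_trans bound); apply: ereal_sup_ubound.
by exists (family_graph vertexK simp).
Qed.

Theorem corollary1 (R : realType) :
  [/\ forall n : nat, (3 <= n)%N ->
        (((embedding_bound n)%:R)%:E <= max_real_embeddings R n)%E,
      (fun n : nat => (embedding_bound n)%:R : R) =Theta_\oo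
        (fun n : nat => ((132 : R) `^ 5^-1) ^+ n)
    & `|(132 : R) `^ 5^-1 - (2 + 655 / 10 ^+ 3 + 3 / 10 ^+ 4)| < 5 / 10 ^+ 5].
Proof.
split; first exact: max_real_embeddings_ge.
  exact: embedding_bound_Theta.
exact: fifth_root_132 (powR_ge0 _ _) (powR132X5 R).
Qed.
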